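(* Let $D\ge 3$ and fix $\beta\in(0,+\infty]$. Let $f:[0,+\infty)\to\mathbb{R}$ be a $C^1$ function with $f\not\equiv 0$, $f(0)=0$, $f(t)>0$ for $t>0$, satisfying the Keller-Osserman condition $\int^{+\infty}\frac{ds}{\sqrt{F(s)}}<+\infty$. Let $\rho:\mathbb{R}^D\to(0,+\infty)$ be a $C^1$ function satisfying $\lim_{|x|\to+\infty}\int_{\mathbb{R}^D}|x-y|^{2-D}\rho(y)\,dy=0$. Suppose also that $f$ is nondecreasing on some interval $[M,\beta)$ (with $M<\beta$), and that $\rho$ is a radially decreasing function (that is, $\rho(x)$ depends only on $|x|$ and is decreasing in $|x|$) such that for some $\alpha>2$, $\rho(x)=|x|^{-\alpha}$ for $|x|\ge1$. Then every solution of $$\Delta u=\rho(x)f(u),\quad u>0\quad\text{in }\mathbb{R}^D,\qquad \lim_{|x|\to+\infty}u(x)=\beta,$$ is radial, i.e. $u(x)$ depends only on $|x|$.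
   Context: Here $F(s)=\int_a^s f(t)\,dt$, where $a>0$ is a fixed constant (since $f>0$ on $(0,+\infty)$, any $a>0$ may be used), and $\int^{+\infty}$ means integration over a neighborhood $[s_0,+\infty)$ of $+\infty$ with some $s_0>a$. Solutions are classical ($C^2(\mathbb{R}^D)$). *)

(* Defs.v *)
From HB Require Import structures.
From mathcomp Require Import all_boot all_order all_algebra.
From mathcomp Require Import all_classical all_reals all_analysis.

Set Implicit Arguments.
Unset Strict Implicit.
Unset Printing Implicit Defensive.

Import Order.TTheory GRing.Theory Num.Theory.
Import numFieldNormedType.Exports.

Local Open Scope classical_set_scope.
Local Open Scope ring_scope.

Section lebesgue_tuple.
Context {R : realType}.

Local Notation TR := (measurableTypeR R).

Definition cons_pair n (p : TR * n.-tuple TR) : n.+1.-tuple TR :=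
  [tuple of p.1 :: p.2].

Lemma measurable_cons_pair n :
  measurable_fun [set: TR * n.-tuple TR] (@cons_pair n).
Proof. by apply: measurable_cons => //; exact: measurable_snd. Qed.

Section step.
Variables (n : nat) (m : {sigma_finite_measure set (n.-tuple TR) -> \bar R}).

Definition lebesgue_tuple_step : set (n.+1.-tuple TR) -> \bar R :=
  pushforward (@lebesgue_measure R \x m)%E (@cons_pair n).

Let step0 : lebesgue_tuple_step set0 = 0%E.
Proof. by rewrite /lebesgue_tuple_step /pushforward preimage_set0 measure0. Qed.

Let step_ge0 A : (0 <= lebesgue_tuple_step A)%E.
Proof. by rewrite /lebesgue_tuple_step /pushforward measure_ge0. Qed.

Let step_sigma_additive : semi_sigma_additive lebesgue_tuple_step.
Proof.
move=> F mF tF mUF; rewrite /lebesgue_tuple_step /pushforward preimage_bigcup.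
apply: measure_semi_sigma_additive.
- by move=> k; rewrite -[X in measurable X]setTI; exact: measurable_cons_pair.
- apply/trivIsetP => /= i j _ _ ij; rewrite -preimage_setI.
  by move/trivIsetP : tF => /(_ _ _ _ _ ij) ->//; rewrite preimage_set0.
- by rewrite -preimage_bigcup -[X in measurable X]setTI;
    exact: measurable_cons_pair.
Qed.

HB.instance Definition _ := isMeasure.Build _ _ _
  lebesgue_tuple_step step0 step_ge0 step_sigma_additive.

Lemma sigma_finite_lebesgue_tuple_step :
  sigma_finite [set: n.+1.-tuple TR] lebesgue_tuple_step.
Proof.
pose mu := @lebesgue_measure R : {sigma_finite_measure set TR -> \bar R}.
have [F [FT mF]] : exists F : (set (TR * n.-tuple TR))^nat,
    [set: _] = \bigcup_k F k /\
    forall k, measurable (F k) /\ ((mu \x m) (F k) < +oo)%E.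
  have /sigma_finiteP[A [TA ndA Aoo]] := sigma_finiteT mu.
  have /sigma_finiteP[B [TB ndB Boo]] := sigma_finiteT m.
  exists (fun k => A k `*` B k); split.
    rewrite -setXTT TA TB predeqE => -[x y]; split.
      move=> [/= [i _ Aix] [j _ Bjy]]; exists (maxn i j) => //; split.
      - by move: x Aix; exact/subsetPset/ndA/leq_maxl.
      - by move: y Bjy; exact/subsetPset/ndB/leq_maxr.
    by move=> [i _ []/= ? ?]; split; exists i.
  move=> k; have [? ?] := Aoo k; have [? ?] := Boo k.
  split; first exact: measurableX.
  by rewrite product_measure1E// lte_mul_pinfty// ge0_fin_numE.
pose g (t : n.+1.-tuple TR) : TR * n.-tuple TR :=
  (thead t, [tuple of behead t]).
have mg : measurable_fun setT g.
  apply/measurable_fun_pairP; split => /=; first exact: measurable_tnth.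
  exact: measurable_behead.
exists (fun k => g @^-1` F k).
  by rewrite -preimage_bigcup -FT preimage_setT.
move=> k; have [mFk Fk] := mF k; split.
  by rewrite -[X in measurable X]setTI; exact: mg.
rewrite /lebesgue_tuple_step /pushforward -comp_preimage.
rewrite (_ : g \o _ = id) ?preimage_id//.
apply/funext => -[x t]; rewrite /g /cons_pair/=; congr pair.
by apply/val_inj.
Qed.

HB.instance Definition _ := @Measure_isSigmaFinite.Build _ _ _
  lebesgue_tuple_step sigma_finite_lebesgue_tuple_step.
End step.

(* Lebesgue measure on R^n (as tuples), as an iterated product measure;
   R^0 carries the unit mass. *)
Fixpoint lebesgue_tuple n : {sigma_finite_measure set (n.-tuple TR) -> \bar R} :=
  if n is n'.+1 then lebesgue_tuple_step (lebesgue_tuple n')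
  else dirac [tuple].

Lemma lebesgue_tuple_box n (A : 'I_n -> set TR) :
  (forall i, measurable (A i)) ->
  lebesgue_tuple n [set t | forall i, A i (tnth t i)] =
  (\prod_(i < n) @lebesgue_measure R (A i))%E.
Proof.
elim: n A => [|n IHn] A mA; first by rewrite big_ord0 /= diracE mem_set// => -[].
rewrite big_ord_recl -IHn => [|i]; last exact: mA.
rewrite /= /lebesgue_tuple_step /pushforward.
rewrite -product_measure1E//; last first.
  rewrite (_ : [set t | _] =
      \bigcap_(i in [set: 'I_n]) (fun t : n.-tuple TR => tnth t i) @^-1`
        A (lift ord0 i)); last first.
    by apply/seteqP; split => t /= At i; [move=> _|]; exact: At.
  apply: fin_bigcap_measurable => // i _; rewrite -[X in measurable X]setTI.
  by apply: measurable_tnth.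
congr (_ _); apply/seteqP; split => -[x t] /=.
  move=> At; split; first by have := At ord0.
  by move=> i; have := At (lift ord0 i); rewrite /cons_pair tnthS.
move=> [Ax At] i; case: (unliftP ord0 i) => [j ->|->//].
by rewrite /cons_pair tnthS.
Qed.

End lebesgue_tuple.

Section euclidean_space.
Context {R : realType} {n : nat}.
Implicit Types (x y : 'rV[R]_n) (g : 'rV[R]_n -> R).

Definition basis_vec (i : 'I_n) : 'rV[R]_n := delta_mx 0 i.

(* The norm `|x| of the library on 'rV[R]_n is the sup norm. *)
Definition enorm x : R := Num.sqrt (\sum_(i < n) x 0 i ^+ 2).

(* The filter of neighbourhoods of infinity: |x| -> +oo. *)
Definition at_infinity : set_system 'rV[R]_n :=
  filter_from [set: R] (fun r => [set x | r < enorm x]).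

Global Instance at_infinity_filter : Filter at_infinity.
Proof.
apply: filter_from_filter; first by exists 0.
move=> r s _ _; exists (Num.max r s) => // x /=.
by rewrite gt_max => /andP[].
Qed.

Definition partial (i : 'I_n) g : 'rV[R]_n -> R := 'D_(basis_vec i) g.

Fixpoint class_C (k : nat) g : Prop :=
  continuous g /\
  if k is k'.+1 then
    forall i, (forall x, derivable g x (basis_vec i)) /\
              class_C k' (partial i g)
  else True.

Definition laplacian g x : R := \sum_(i < n) partial i (partial i g) x.

Definition radial g : Prop := forall x y, enorm x = enorm y -> g x = g y.

Definition radially_decreasing g : Prop :=
  radial g /\ forall x y, enorm x < enorm y -> g y < g x.

Definition integral_rV (h : 'rV[R]_n -> \bar R) : \bar R :=
  (\int[lebesgue_tuple n]_t h (\row_i tnth t i))%E.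

(* The integral of |x-y|^(2-n) rho(y) dy for n >= 3.  The integrand is given
   the value 0 on the null set y = x, since 0^-1 = 0. *)
Definition newton_potential (rho : 'rV[R]_n -> R) x : \bar R :=
  integral_rV (fun y => (enorm (x - y) ^- (n - 2) * rho y)%:E).

End euclidean_space.

Section half_line.
Context {R : realType}.
Implicit Types f : R -> R.

(* f is C^1 on [0,+oo), with a one-sided derivative at 0; values of f at
   negative reals are irrelevant. *)
Definition C1_half_line f : Prop :=
  exists f' : R -> R,
    (forall t, 0 <= t ->
       (f s - f t) / (s - t) @[s --> within `[0, +oo[%classic t^'] --> f' t) /\
    {within `[0, +oo[, continuous f'}.

Definition primitive_from (a : R) f (s : R) : R :=
  \int[@lebesgue_measure R]_(t in `[a, s]) f t.

Definition keller_osserman (a : R) f : Prop :=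
  exists2 s0, a < s0 &
    (\int[@lebesgue_measure R]_(s in `[s0, +oo[)
       ((Num.sqrt (primitive_from a f s))^-1)%:E < +oo)%E.

End half_line.

(* Main.v *)
Require Import Defs.
From HB Require Import structures.
From mathcomp Require Import all_boot all_order all_algebra.
From mathcomp Require Import all_classical all_reals all_analysis.
From mathcomp Require Import ring lra.

Set Implicit Arguments.
Unset Strict Implicit.
Unset Printing Implicit Defensive.

Import Order.TTheory GRing.Theory Num.Theory.
Import numFieldNormedType.Exports.

Local Open Scope classical_set_scope.
Local Open Scope ring_scope.

(** Write s(x) = |x|^(-1/N) with N so large that N (alpha - 2) > 2.  The proof
    has two halves: a comparison of the values of u near infinity, and the
    method of moving planes.

    Moving planes.  For a unit vector e and l > 0 let x' be the mirror image of
    x in the hyperplane x.e = l and w(x) = u(x) - u(x').  On the side x.e > l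
    one has |x'| < |x|, so rho(x) < rho(x').  At a negative minimum x of w
    outside a large ball, monotonicity of f near beta gives
    rho(x) f(u(x)) < rho(x') f(u(x')), that is, Lap w < 0: no such minimum
    exists.  Inside the ball but close to the hyperplane, f is Lipschitz and a
    bounded, strictly concave function of x.e - l takes over
    ([plane_step]).  In the rest of the ball, w > 0 is an open
    condition on l, by compactness.  Hence the set of l with w >= 0 is closed
    from the right, open to the left, and contains all large l, so it contains
    every l >= 0 ([plane_le0]); l = 0 for all e says that u is radial
    ([radial_of_reflections]).  That w > 0 off the hyperplane
    once w >= 0 follows from rho(x) < rho(x') ([plane_le_strict]).

    For a negative infimum of w to be attained, w must have a nonnegative lower
    limit at infinity.  This is clear if beta is finite.

    Comparison at infinity, beta infinite ([almost_monotone]): for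
    r <= |x| < |y| one has u(x) <= u(y) + o(1) as r tends to infinity.  In the
    variable s, the equation on radial functions reads
      v_ss - (k - 1/N) N v_s / s = N^2 s^(N (alpha - 2) - 2) f(v),  k = D - 2,
    and translation s -> s - eta turns an increasing (in |x|) solution into a
    supersolution which is infinite on the finite sphere s = eta.  To use this
    for u itself, which need not be radial, the variables are doubled: one
    maximises u(x) - u(y) - h(x) over s(x) >= s(y) + eta, where h is the
    multiple of the harmonic function |x|^(2-D) that dominates u on an inner
    sphere.  At a positive maximum, x may move along its sphere, y along its
    own, both radially with the same increment of s, and y alone outwards.
    The first two give bounds for Lap u(x) and Lap u(y) by radial derivatives
    ([sphere_max_test], [sphere_min_test]), the third compares the radial
    derivatives at x and at y, the last gives the sign of the one at y.
    Together ([radial_algebra]) they contradict u(x) > u(y) and the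
    monotonicity of f ([doubling_bound]).  Letting eta tend to 0 leaves
    u(x) <= u(y) + h(x), and h vanishes at infinity.

    All tests at extremal points are made on curves: along a curve with a
    second order expansion, u has a second order expansion ([jet2_curve])
    whose coefficients at an extremum have a sign ([jet2_min], [jet2_max]). *)

(** * Second order expansions at 0 *)

Section jets.
Context {R : realType}.
Implicit Types (phi psi : R -> R) (a b c : R).

(** Only an expansion at the point is asked for, not differentiability near it:
    this is what extremum tests use and what composition with curves keeps. *)
Definition jet2 phi c a b := forall e, 0 < e ->
  \forall t \near 0, `|phi t - (c + a * t + b * t ^+ 2)| <= e * t ^+ 2.

Lemma near0_le e : 0 < e -> \forall t \near (0 : R), `|t| <= e.
Proof.
move=> e0; apply/nbhs_ballP; exists e => //= t.
by rewrite /ball /= sub0r normrN => /ltW.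
Qed.

Lemma jet2_poly c a b : jet2 (fun t => c + a * t + b * t ^+ 2) c a b.
Proof.
by move=> e e0; near=> t; rewrite subrr normr0 mulr_ge0 ?sqr_ge0 ?ltW.
Unshelve. all: by end_near. Qed.

Lemma jet2_ext phi psi c a b c' a' b' : phi =1 psi -> c = c' -> a = a' ->
  b = b' -> jet2 phi c a b -> jet2 psi c' a' b'.
Proof. by move=> /funext-> -> -> ->. Qed.

Lemma jet2_cst c : jet2 (fun=> c) c 0 0.
Proof.
by apply: jet2_ext (jet2_poly c 0 0) => // t; rewrite !mul0r !addr0.
Qed.

Lemma jet2D phi psi c a b c' a' b' : jet2 phi c a b -> jet2 psi c' a' b' ->
  jet2 (fun t => phi t + psi t) (c + c') (a + a') (b + b').
Proof.
move=> h h' e e0; have e20 : 0 < e / 2 by rewrite divr_gt0.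
near=> t.
have H : `|phi t - (c + a * t + b * t ^+ 2)| <= e / 2 * t ^+ 2.
  by near: t; exact: h.
have H' : `|psi t - (c' + a' * t + b' * t ^+ 2)| <= e / 2 * t ^+ 2.
  by near: t; exact: h'.
apply: le_trans (_ : `|phi t - (c + a * t + b * t ^+ 2)| +
  `|psi t - (c' + a' * t + b' * t ^+ 2)| <= _); last by lra.
by apply: le_trans (ler_normD _ _); rewrite le_eqVlt; apply/orP; left;
  apply/eqP; congr (`|_|); ring.
Unshelve. all: by end_near. Qed.

Lemma jet2M phi psi c a b c' a' b' : jet2 phi c a b -> jet2 psi c' a' b' ->
  jet2 (fun t => phi t * psi t) (c * c') (c * a' + a * c')
       (c * b' + a * a' + b * c').
Proof.
move=> h h' e e0.
pose K := `|c| + `|a| + `|b| + 1; pose K' := `|c'| + `|a'| + `|b'| + 1.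
have K1 : 1 <= K by rewrite /K lerDr !addr_ge0.
have K'1 : 1 <= K' by rewrite /K' lerDr !addr_ge0.
have K0 : 0 < K by lra.
have K'0 : 0 < K' by lra.
pose d := e / (4 * K * K').
have d0 : 0 < d by rewrite /d divr_gt0 // !mulr_gt0.
have KK0 : 0 < K * K' by rewrite mulr_gt0.
have eE : 4 * d * (K * K') = e by rewrite /d; field; rewrite !gt_eqF.
near=> t.
have t1 : `|t| <= 1 by near: t; exact: near0_le.
have td : `|t| <= d by near: t; exact: near0_le.
have tsq : t ^+ 2 <= 1.
  by rewrite -real_normK ?num_real // expr_le1.
pose P := c + a * t + b * t ^+ 2; pose P' := c' + a' * t + b' * t ^+ 2.
have bnd x y z : `|x + y * t + z * t ^+ 2| <= `|x| + `|y| + `|z|.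
  rewrite (le_trans (ler_normD _ _)) // lerD //; last first.
    by rewrite normrM (ger0_norm (sqr_ge0 _)) ler_piMr.
  by rewrite (le_trans (ler_normD _ _)) // lerD // normrM ler_piMr.
have H : `|phi t - (c + a * t + b * t ^+ 2)| <= d * t ^+ 2.
  by near: t; exact: h.
have H' : `|psi t - (c' + a' * t + b' * t ^+ 2)| <= d * t ^+ 2.
  by near: t; exact: h'.
have H1 : `|psi t - (c' + a' * t + b' * t ^+ 2)| <= 1 * t ^+ 2.
  by near: t; exact: h'.
rewrite -/P -/P' mul1r in H H' H1.
have hP : `|P| <= K by rewrite /K (le_trans (bnd _ _ _)) // lerDl.
have hpsi : `|psi t| <= K'.
  have -> : psi t = (psi t - P') + P' by ring.
  rewrite (le_trans (ler_normD _ _)) // /K' [leRHS]addrC lerD //; last first.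
    exact: bnd.
  by rewrite (le_trans H1).
have -> : phi t * psi t - (c * c' + (c * a' + a * c') * t +
    (c * b' + a * a' + b * c') * t ^+ 2) =
  (phi t - P) * psi t + P * (psi t - P') +
  t * (a * b' + a' * b + b * b' * t) * t ^+ 2 by rewrite /P /P'; ring.
have t20 : 0 <= t ^+ 2 by exact: sqr_ge0.
have B1 : `|(phi t - P) * psi t| <= d * (K * K') * t ^+ 2.
  rewrite normrM (le_trans (ler_pM _ _ H hpsi)) //.
  rewrite [leLHS]mulrAC ler_wpM2r // ler_wpM2l ?(ltW d0) //.
  by rewrite ler_peMl // ltW.
have B2 : `|P * (psi t - P')| <= d * (K * K') * t ^+ 2.
  rewrite normrM (le_trans (ler_pM _ _ hP H')) //.
  rewrite mulrA ler_wpM2r // mulrC ler_wpM2l ?(ltW d0) //.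
  by rewrite ler_peMr // ltW.
have B3 : `|t * (a * b' + a' * b + b * b' * t) * t ^+ 2| <=
    2 * d * (K * K') * t ^+ 2.
  rewrite normrM (ger0_norm t20) ler_wpM2r // normrM.
  have aux : `|a * b' + a' * b + b * b' * t| <= 2 * (K * K').
    rewrite (le_trans (ler_normD _ _)) //.
    have X1 : `|a * b' + a' * b| <= `|a| * `|b'| + `|a'| * `|b|.
      by rewrite (le_trans (ler_normD _ _)) // !normrM.
    have X2 : `|b * b' * t| <= `|b| * `|b'|.
      by rewrite !normrM ler_piMr // mulr_ge0.
    have := normr_ge0 a; have := normr_ge0 b; have := normr_ge0 c.
    have := normr_ge0 a'; have := normr_ge0 b'; have := normr_ge0 c'.
    rewrite /K /K'; nra.
  by rewrite (le_trans (ler_pM _ _ td aux)) //; lra.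
apply: le_trans (ler_normD _ _) _.
have := ler_normD ((phi t - P) * psi t) (P * (psi t - P')).
rewrite -eE; lra.
Unshelve. all: by end_near. Qed.

Lemma jet2Z k phi c a b : jet2 phi c a b ->
  jet2 (fun t => k * phi t) (k * c) (k * a) (k * b).
Proof.
by move=> h; apply: jet2_ext (jet2M (jet2_cst k) h) => //; ring.
Qed.

(** If Q denotes the expected expansion, phi Q = 1 + o(t^2) by the product rule,
    and phi^-1 - Q is phi^-1 (1 - phi Q). *)
Lemma jet2V phi a b : jet2 phi 1 a b ->
  jet2 (fun t => (phi t)^-1) 1 (- a) (a ^+ 2 - b).
Proof.
move=> h e e0; have e2 : 0 < e / 2 by rewrite divr_gt0.
have hQ : jet2 (fun t => phi t * (1 + - a * t + (a ^+ 2 - b) * t ^+ 2)) 1 0 0.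
  by apply: jet2_ext (jet2M h (jet2_poly _ _ _)) => //; ring.
near=> t.
have HQ : `|phi t * (1 + - a * t + (a ^+ 2 - b) * t ^+ 2) -
    (1 + 0 * t + 0 * t ^+ 2)| <= e / 2 * t ^+ 2 by near: t; exact: hQ.
move: HQ; rewrite !mul0r !addr0; set Q := 1 + _ + _ => HQ.
have hp : 1 / 2 <= phi t.
  have H : `|phi t - (1 + a * t + b * t ^+ 2)| <= 1 * t ^+ 2.
    by near: t; exact: h.
  pose K := `|a| + `|b| + 1.
  have K0 : 0 < K by rewrite /K ltr_wpDl // addr_ge0.
  have tK : `|t| <= 1 / (2 * K).
    by near: t; apply: near0_le; rewrite divr_gt0 // mulr_gt0.
  have t1 : `|t| <= 1 by near: t; exact: near0_le.
  have tt : t ^+ 2 <= `|t|.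
    by rewrite -real_normK ?num_real // expr2 ler_piMr.
  have X1 : `|a * t| <= `|a| * `|t| by rewrite normrM.
  have X2 : `|b * t ^+ 2| <= `|b| * `|t|.
    by rewrite normrM ler_wpM2l // ger0_norm ?sqr_ge0.
  have X3 : K * `|t| <= 1 / 2.
    apply: le_trans (ler_wpM2l (ltW K0) tK) _.
    by rewrite le_eqVlt; apply/orP; left; apply/eqP; field; rewrite gt_eqF.
  move: X1 X2 H; rewrite !ler_norml => /andP[? _] /andP[? _] /andP[? _].
  move: X3; rewrite /K; nra.
have hp0 : 0 < phi t by lra.
have -> : (phi t)^-1 - Q = - ((phi t)^-1 * (phi t * Q - 1)).
  by field; rewrite gt_eqF.
have hi : (phi t)^-1 <= 2.
  by rewrite invf_ple ?posrE //; lra.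
have hi0 : 0 < (phi t)^-1 by rewrite invr_gt0.
rewrite normrN normrM (gtr0_norm hi0).
apply: le_trans (ler_pM (ltW hi0) (normr_ge0 _) hi HQ) _; lra.
Unshelve. all: by end_near. Qed.

Lemma jet2_sum (I : Type) (r : seq I) (phi c a b : I -> _) :
  (forall i, jet2 (phi i) (c i) (a i) (b i)) ->
  jet2 (fun t => \sum_(i <- r) phi i t) (\sum_(i <- r) c i)
    (\sum_(i <- r) a i) (\sum_(i <- r) b i).
Proof.
move=> h; elim: r => [|i r IH].
  by rewrite !big_nil; apply: jet2_ext (jet2_cst 0) => // t; rewrite big_nil.
rewrite !big_cons; apply: jet2_ext (jet2D (h i) IH) => // t.
by rewrite big_cons.
Qed.

(** One-sided test: it yields the sign of a derivative when motion is allowed in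
    one direction only. *)
Lemma jet2_min_left phi c a b : jet2 phi c a b ->
  (\forall t \near 0, t <= 0 -> c <= phi t) -> a <= 0.
Proof.
move=> h hm; rewrite leNgt; apply/negP => a0.
have /nbhs_ballP[d /= d0 H] :
    \forall t \near 0, `|phi t - (c + a * t + b * t ^+ 2)| <= 1 * t ^+ 2 /\
      (t <= 0 -> c <= phi t).
  by near do split; [exact: h | exact: hm].
have K0 : 0 < `|b| + 1 by rewrite ltr_wpDl.
(* at t = - s the linear term a t outweighs (|b| + 1) t^2 *)
pose s := Num.min (d / 2) (a / (2 * (`|b| + 1))).
have s0 : 0 < s by rewrite lt_min !divr_gt0 // mulr_gt0.
have sd : s < d by rewrite gt_min; apply/orP; left; lra.
have sa : (`|b| + 1) * s <= a / 2.
  have : s <= a / (2 * (`|b| + 1)) by rewrite ge_min lexx orbT.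
  move=> /(ler_wpM2l (ltW K0)) /le_trans; apply.
  by rewrite le_eqVlt; apply/orP; left; apply/eqP; field; rewrite gt_eqF.
have [] := H (- s).
  by rewrite /ball /= sub0r opprK gtr0_norm.
rewrite ler_norml => /andP[_ h1] h2.
have {h2} := h2 ltac:(rewrite oppr_le0; exact: ltW).
have := ler_norm b; nra.
Unshelve. all: by end_near. Qed.

Lemma jet2_comp_opp phi c a b : jet2 phi c a b ->
  jet2 (fun t => phi (- t)) c (- a) b.
Proof.
move=> h e e0; have /nbhs_ballP[d /= d0 H] := h e e0.
apply/nbhs_ballP; exists d => //= t; rewrite /ball /= sub0r normrN => td.
have := H (- t); rewrite /ball /= sub0r opprK sqrrN => /(_ td).
by rewrite mulrN mulNr.
Qed.

Lemma jet2_min phi c a b : jet2 phi c a b ->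
  (\forall t \near 0, c <= phi t) -> a = 0 /\ 0 <= b.
Proof.
move=> h hm; have a0 : a = 0.
  apply/eqP; rewrite eq_le; apply/andP; split.
    by apply: (jet2_min_left h); apply: filterS hm.
  rewrite -oppr_le0; apply: (jet2_min_left (jet2_comp_opp h)).
  have /nbhs_ballP[d /= d0 H] := hm.
  apply/nbhs_ballP; exists d => //= t td _; apply: H.
  by move: td; rewrite /ball /= !sub0r !normrN.
split=> //; rewrite leNgt; apply/negP => b0.
have b20 : 0 < - b / 2 by lra.
have /nbhs_ballP[d /= d0 H] :
    \forall t \near 0, `|phi t - (c + a * t + b * t ^+ 2)| <= - b / 2 * t ^+ 2 /\
      (c <= phi t).
  by near do split; [exact: h | exact: hm].
have [] := H (d / 2).
  by rewrite /ball /= sub0r normrN gtr0_norm ?divr_gt0 //; lra.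
rewrite a0 ler_norml => /andP[_ h1] h2.
have : 0 < (d / 2) ^+ 2 by rewrite exprn_gt0 // divr_gt0.
nra.
Unshelve. all: by end_near. Qed.

Lemma jet2_max phi c a b : jet2 phi c a b ->
  (\forall t \near 0, phi t <= c) -> a = 0 /\ b <= 0.
Proof.
move=> /(jet2Z (- 1)) h hm.
have [|h1 h2] := jet2_min h.
  by apply: filterS hm => t; rewrite !mulN1r lerN2.
by split; lra.
Qed.

End jets.

(** * Taylor expansion of C^2 functions *)

Section one_variable.
Context {R : realType}.
Implicit Types phi : R -> R.

Lemma is_derive_eps phi (t L : R) :
  (forall e, 0 < e ->
     \forall s \near 0, `|phi (s + t) - phi t - s * L| <= e * `|s|) ->
  is_derive t 1 phi L.
Proof.
move=> h.
have H : (fun s => s^-1 *: (phi (s *: 1 + t) - phi t)) @ 0^' --> L.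
  apply/cvgrPdist_le => e e0; rewrite near_withinE; near=> s => s0.
  have Hs : `|phi (s + t) - phi t - s * L| <= e * `|s| by near: s; exact: h.
  rewrite -[s *: 1]/(s * 1) mulr1 distrC.
  have -> : s^-1 *: (phi (s + t) - phi t) - L =
      s^-1 * (phi (s + t) - phi t - s * L).
    by rewrite -[_ *: _]/(_ * _); field.
  by rewrite normrM normfV mulrC ler_pdivrMr ?normr_gt0.
split; first by apply/cvg_ex; exists L.
exact: cvg_lim.
Unshelve. all: by end_near. Qed.

Lemma mvt0 phi (dphi : R -> R) (h : R) :
  (forall t : R, is_derive t 1 phi (dphi t)) ->
  exists2 c, `|c| <= `|h| & phi h - phi 0 = dphi c * h.
Proof.
move=> d.
have cphi (A : set R) : {within A, continuous phi}.
  apply: continuous_subspaceT => t.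
  by apply/differentiable_continuous/derivable1_diffP; case: (d t).
have [h0|h0] := leP 0 h.
  have [c + ->] := MVT_segment h0 (fun t _ => d t) (cphi _).
  rewrite in_itv /= => /andP[c0 ch]; exists c; last by rewrite subr0.
  by rewrite !ger0_norm.
have [c + E] := MVT_segment (ltW h0) (fun t _ => d t) (cphi _).
rewrite in_itv /= => /andP[c0 ch]; exists c.
  by rewrite !ler0_norm ?lerN2 // ltW.
by rewrite -opprB E; ring.
Qed.

End one_variable.

(** [grad] and [half_hess] are locked because comparing two of their values by
    conversion would unfold limits of difference quotients. *)
HB.lock Definition grad (R : realType) (n : nat) (g : 'rV[R]_n -> R)
    (x : 'rV[R]_n) : 'rV[R]_n :=
  \row_i partial i g x.

(** The factor 1/2 makes [half_hess] the matrix of the second order Taylor term;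
    its trace is half the Laplacian. *)
HB.lock Definition half_hess (R : realType) (n : nat) (g : 'rV[R]_n -> R)
    (x : 'rV[R]_n) : 'M[R]_n :=
  \matrix_(i, j) (2^-1 * partial j (partial i g) x).

Section euclidean.
Context {R : realType} {n : nat}.
Implicit Types (x y h v w : 'rV[R]_n) (g : 'rV[R]_n -> R) (B : 'M[R]_n).

Definition dot x y : R := \sum_i x 0 i * y 0 i.

Definition bilin B v w : R := \sum_i \sum_j B i j * (v 0 i * w 0 j).

Definition quad B v : R := bilin B v v.

Lemma tr_half_hess g x : \tr (half_hess g x) = laplacian g x / 2.
Proof.
rewrite /mxtrace /laplacian mulr_suml; apply: eq_bigr => i _.
by rewrite half_hess.unlock mxE mulrC.
Qed.

Lemma sup_norm_ge x i : `|x 0 i| <= `|x|.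
Proof.
rewrite [leRHS]/Num.Def.normr /= mx_normrE; apply/bigmax_geP; right => /=.
by exists (0, i).
Qed.

Lemma sup_norm_le x e : 0 <= e -> (forall i, `|x 0 i| <= e) -> `|x| <= e.
Proof.
move=> e0 h; rewrite [leLHS]/Num.Def.normr /= mx_normrE.
rewrite (bigmax_le _ e0) //= => -[j i] _.
by rewrite (ord1 j); exact: h.
Qed.

(** Continuous partial derivatives imply differentiability: change the
    coordinates one at a time and apply the mean value theorem to each step. *)
Lemma C1_frechet g x (e : R) : class_C 1 g -> 0 < e ->
  \forall h \near (0 : 'rV[R]_n),
    `|g (x + h) - g x - dot (grad g x) h| <= e * `|h|.
Proof.
move=> [_ gC] e0.
pose e' := e / n.+1%:R.
have e'0 : 0 < e' by rewrite divr_gt0.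
have [d d0 H] : exists2 d : R, 0 < d & forall i y, `|y - x| <= d ->
    `|partial i g y - partial i g x| <= e'.
  have : \forall y \near x, forall i, `|partial i g y - partial i g x| <= e'.
    have ci i : \forall y \near x, `|partial i g y - partial i g x| <= e'.
      have [_ [c _]] := gC i; have /cvgrPdist_le /(_ _ e'0) := c x.
      by apply: filterS => y; rewrite distrC.
    exact: filter_forall ci.
  move=> /nbhs_ballP[d /= d0 H]; exists (d / 2); first by rewrite divr_gt0.
  move=> i y yx; apply: H; rewrite -ball_normE /= distrC.
  by rewrite (le_lt_trans yx) // ltr_pdivrMr // ltr_pMr // ltr1n.
apply/nbhs_ballP; exists d => //= h; rewrite -ball_normE /= sub0r normrN => hd.
pose p k : 'rV[R]_n := x + \row_j (if (j < k)%N then h 0 j else 0).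
have pS (k : 'I_n) : p k.+1 = p k + h 0 k *: basis_vec k.
  apply/rowP => j; rewrite !mxE -addrA; congr (_ + _).
  rewrite ltnS leq_eqVlt eqxx /= -val_eqE /=; case: ltngtP => jk /=.
  - by rewrite mulr0 addr0.
  - by rewrite mulr0 addr0.
  - by rewrite mulr1 add0r (val_inj jk).
have step (k : 'I_n) :
    `|g (p k.+1) - g (p k) - partial k g x * h 0 k| <= e' * `|h|.
  have dl (t : R) : is_derive t 1 (fun s => g (p k + s *: basis_vec k))
      (partial k g (p k + t *: basis_vec k)).
    have [dg _] := gC k; have := dg (p k + t *: basis_vec k).
    rewrite /derivable /partial /derive => dgt.
    have E : (fun s => s^-1 *: (g (p k + (s *: 1 + t) *: basis_vec k) -
        g (p k + t *: basis_vec k))) =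
      (fun s => s^-1 *: (g (s *: basis_vec k + (p k + t *: basis_vec k)) -
        g (p k + t *: basis_vec k))).
      apply/funext => s; congr (_ *: (g _ - _)).
      by rewrite -[s *: 1]/(s * 1) mulr1 scalerDl addrCA.
    by split; rewrite ?/derivable ?/derive /= E.
  have [c hc] := mvt0 (h 0 k) dl; rewrite scale0r addr0 -pS => ->.
  rewrite -mulrBl normrM ler_pM ?sup_norm_ge // H //.
  apply: le_trans (ltW hd); apply: sup_norm_le => // i.
  rewrite !mxE; case: ltnP => ik; last first.
    rewrite eqxx /= addr0 addrAC subrr add0r.
    case: (i == k); last by rewrite mulr0 normr0.
    by rewrite mulr1 (le_trans hc) // sup_norm_ge.
  rewrite eqxx /= (_ : i == k = false) ?mulr0 ?addr0; last first.
    by apply/eqP => ikE; rewrite ikE ltnn in ik.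
  by rewrite addrAC subrr add0r sup_norm_ge.
have p0 : p 0 = x by apply/rowP => j; rewrite !mxE /= addr0.
have pn : p n = x + h.
  by apply/rowP => j; rewrite !mxE ltn_ord.
have -> : g (x + h) - g x - dot (grad g x) h =
    \sum_(k < n) (g (p k.+1) - g (p k) - partial k g x * h 0 k).
  rewrite sumrB -(big_mkord xpredT (fun k => g (p k.+1) - g (p k))).
  rewrite telescope_sumr // pn p0; congr (_ - _).
  by apply: eq_bigr => k _; rewrite grad.unlock mxE.
apply: le_trans (ler_norm_sum _ _ _) _.
apply: le_trans (ler_sum _ (fun k _ => step k)) _.
rewrite sumr_const card_ord -mulr_natl mulrA ler_wpM2r // /e'.
by rewrite mulrCA ler_piMr ?(ltW e0) // ler_pdivrMr // mul1r ler_nat.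
Qed.

Lemma C1_is_derive_line g x v (t : R) : class_C 1 g ->
  is_derive t 1 (fun s => g (x + s *: v)) (dot (grad g (x + t *: v)) v).
Proof.
move=> gC; apply: is_derive_eps => e e0.
pose K := `|v| + 1; have K0 : 0 < K by rewrite ltr_wpDl.
have eK : 0 < e / K by rewrite divr_gt0.
have /nbhs_ballP[d /= d0 H] := C1_frechet (x + t *: v) gC eK.
apply/nbhs_ballP; exists (d / K) => /=; first by rewrite divr_gt0.
move=> s; rewrite /ball /= sub0r normrN ltr_pdivlMr // => sd.
have sv : `|s *: v| <= `|s| * K by rewrite normrZ ler_wpM2l // lerDl.
have := H (s *: v); rewrite -ball_normE /= sub0r normrN.
move=> /(_ (le_lt_trans sv sd)).
have -> : x + t *: v + s *: v = x + (s + t) *: v.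
  by rewrite scalerDl addrAC addrA.
have -> : dot (grad g (x + t *: v)) (s *: v) = s * dot (grad g (x + t *: v)) v.
  by rewrite /dot mulr_sumr; apply: eq_bigr => i _; rewrite !mxE; ring.
move=> /le_trans; apply; rewrite (le_trans (ler_wpM2l (ltW eK) sv)) //.
by rewrite le_eqVlt; apply/orP; left; apply/eqP; field; rewrite gt_eqF.
Qed.

Lemma class_CW k g : class_C k.+1 g -> class_C k g.
Proof.
elim: k g => [|k IH] g; first by case.
move=> [cg H]; split => // i; have [di ci] := H i.
by split => //; exact: IH.
Qed.

(** Along the segment from x to x + h, subtract the second order Taylor
    polynomial.  The derivative of the difference is o(|h|^2), because every
    partial derivative of g is differentiable at x; conclude with the mean value
    theorem. *)
Lemma C2_taylor g x (e : R) : class_C 2 g -> 0 < e ->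
  \forall h \near (0 : 'rV[R]_n),
    `|g (x + h) - (g x + dot (grad g x) h + quad (half_hess g x) h)| <=
    e * `|h| ^+ 2.
Proof.
move=> gC e0.
have gC1 : class_C 1 g := class_CW gC.
pose e' := e / n.+1%:R.
have e'0 : 0 < e' by rewrite divr_gt0.
have : \forall h \near (0 : 'rV[R]_n), forall i,
    `|partial i g (x + h) - partial i g x - dot (grad (partial i g) x) h|
    <= e' * `|h|.
  have Hi i := @C1_frechet (partial i g) x e' (proj2 (proj2 gC i)) e'0.
  exact: filter_forall Hi.
move=> /nbhs_ballP[d /= d0 H].
apply/nbhs_ballP; exists d => //= h; rewrite -ball_normE /= sub0r normrN => hd.
set G := dot (grad g x) h; set Q := quad _ _.
pose psi t := g (x + t *: h) - t * G - t ^+ 2 * Q.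
have dpsi (t : R) :
    is_derive t 1 psi (dot (grad g (x + t *: h)) h - G - 2 * t * Q).
  have dl := C1_is_derive_line x h t gC1.
  have -> : psi = (fun s => g (x + s *: h)) + (fun s => - G * s) +
      (fun s => - Q * s ^+ 2).
    by apply/funext => s; rewrite /psi /= !fctE; ring.
  have d1 : is_derive t 1 (fun s : R => - G * s) (- G).
    apply: is_derive_eps => r r0; near=> s.
    have -> : - G * (s + t) - - G * t - s * - G = 0 by ring.
    by rewrite normr0 mulr_ge0 // ltW.
  have d2 : is_derive t 1 (fun s : R => - Q * s ^+ 2) (- Q * (2 * t)).
    apply: is_derive_eps => r r0; near=> s.
    have -> : - Q * (s + t) ^+ 2 - - Q * t ^+ 2 - s * (- Q * (2 * t)) =
      - Q * s * s by ring.
    rewrite normrM ler_wpM2r // normrM normrN.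
    have K0 : 0 < `|Q| + 1 by rewrite ltr_wpDl.
    have : `|s| <= r / (`|Q| + 1) by near: s; apply: near0_le; rewrite divr_gt0.
    rewrite ler_pdivlMr // => /(le_trans _); apply.
    by rewrite mulrC ler_wpM2l // lerDl.
  have := is_deriveD (is_deriveD dl d1) d2.
  by congr (is_derive _ _ _ _); ring.
have [c + E] := mvt0 1 dpsi; rewrite normr1 => c1.
have -> : g (x + h) - (g x + G + Q) = psi 1 - psi 0.
  by rewrite /psi scale1r scale0r addr0; ring.
rewrite E mulr1.
have -> : dot (grad g (x + c *: h)) h - G - 2 * c * Q = \sum_i
   (partial i g (x + c *: h) - partial i g x -
     dot (grad (partial i g) x) (c *: h)) * h 0 i.
  rewrite /G /Q /dot /quad /bilin mulr_sumr -!sumrB; apply: eq_bigr => i _.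
  rewrite grad.unlock half_hess.unlock !mxE 2!mulrBl; congr (_ - _).
  rewrite mulr_sumr mulr_suml; apply: eq_bigr => j _; rewrite !mxE.
  by field.
apply: le_trans (ler_norm_sum _ _ _) _.
have step i : `|(partial i g (x + c *: h) - partial i g x -
     dot (grad (partial i g) x) (c *: h)) * h 0 i| <= e' * `|h| ^+ 2.
  rewrite normrM expr2 mulrA ler_pM ?sup_norm_ge //.
  have ch : `|c *: h| <= `|h| by rewrite normrZ ler_piMl.
  apply: (le_trans (H (c *: h) _ i)); last by rewrite ler_wpM2l // ltW.
  by rewrite -ball_normE /= sub0r normrN (le_lt_trans ch).
apply: le_trans (ler_sum _ (fun k _ => step k)) _.
rewrite sumr_const card_ord -mulr_natl mulrA ler_wpM2r ?sqr_ge0 // /e'.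
by rewrite mulrCA ler_piMr ?(ltW e0) // ler_pdivrMr // mul1r ler_nat.
Unshelve. all: by end_near. Qed.

(** The acceleration w of the curve enters through the gradient; this is where
    the curvature of a sphere shows up in tests along it. *)
Lemma jet2_curve g x v w (c : R -> 'rV[R]_n) : class_C 2 g ->
  (forall i, jet2 (fun t => c t 0 i) (x 0 i) (v 0 i) (w 0 i)) ->
  jet2 (fun t => g (c t)) (g x) (dot (grad g x) v)
    (quad (half_hess g x) v + dot (grad g x) w).
Proof.
move=> gC hc.
have dj i : jet2 (fun t => (c t - x) 0 i) 0 (v 0 i) (w 0 i).
  apply: jet2_ext (jet2D (hc i) (jet2_cst (- x 0 i))) => [t|||]; rewrite ?mxE //.
  - by rewrite subrr.
  - by rewrite addr0.
  - by rewrite addr0.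
set G := grad g x; set B := half_hess g x.
have J : jet2 (fun t => g x + dot G (c t - x) + quad B (c t - x)) (g x)
    (dot G v) (quad B v + dot G w).
  have J1 := jet2_sum (index_enum 'I_n) (fun i => jet2Z (G 0 i) (dj i)).
  have J2 := jet2_sum (index_enum 'I_n) (fun i =>
    jet2_sum (index_enum 'I_n) (fun j => jet2Z (B i j) (jet2M (dj i) (dj j)))).
  apply: jet2_ext (jet2D (jet2D (jet2_cst (g x)) J1) J2) => //.
  - rewrite [X in _ + X + _]big1 ?[X in _ + X]big1 ?addr0 // => i _.
      by rewrite big1 // => j _; rewrite !mulr0.
    by rewrite mulr0.
  - rewrite add0r [X in _ + X]big1 ?addr0 // => i _; rewrite big1 // => j _; ring.
  - rewrite add0r addrC; congr (_ + _); apply: eq_bigr => i _.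
    by apply: eq_bigr => j _; ring.
pose K := \sum_i (`|v 0 i| + `|w 0 i| + 1) + 1.
have K0 : 0 < K.
  by rewrite /K ltr_wpDl // sumr_ge0 // => i _; rewrite !addr_ge0.
(* hence an error o(|c t - x|^2) is an error o(t^2) *)
have dK : \forall t \near (0 : R), `|c t - x| <= K * `|t|.
  have : \forall t \near (0 : R), forall i,
      `|(c t - x) 0 i - (0 + v 0 i * t + w 0 i * t ^+ 2)| <= 1 * t ^+ 2.
    by have dj1 i := dj i 1 ltr01; exact: filter_forall dj1.
  move=> H; near=> t.
  have t1 : `|t| <= 1 by near: t; exact: near0_le.
  have tt : t ^+ 2 <= `|t|.
    by rewrite -real_normK ?num_real // expr2 ler_piMr.
  have Ht i : `|(c t - x) 0 i - (0 + v 0 i * t + w 0 i * t ^+ 2)| <= 1 * t ^+ 2.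
    by move: i; near: t.
  apply: sup_norm_le => [|i]; first by rewrite mulr_ge0 // ltW.
  have X : `|v 0 i| + `|w 0 i| + 1 <= K.
    rewrite /K (bigD1 i) //=; set S := \sum_(_ | _) _.
    suff : 0 <= S by move=> ?; lra.
    by apply: sumr_ge0 => j _; rewrite !addr_ge0.
  have -> : (c t - x) 0 i = ((c t - x) 0 i - (0 + v 0 i * t + w 0 i * t ^+ 2)) +
    v 0 i * t + w 0 i * t ^+ 2 by ring.
  rewrite (le_trans (ler_normD _ _)) //.
  have Y := ler_normD ((c t - x) 0 i - (0 + v 0 i * t + w 0 i * t ^+ 2)) (v 0 i * t).
  have := Ht i.
  have : `|w 0 i * t ^+ 2| <= `|w 0 i| * `|t|.
    by rewrite normrM ler_wpM2l // ger0_norm ?sqr_ge0.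
  move: Y X; rewrite (normrM (v 0 i)); have := normr_ge0 t; nra.
move=> e e0; have e2 : 0 < e / 2 by rewrite divr_gt0.
have eK : 0 < e / 2 / K ^+ 2 by rewrite divr_gt0 // exprn_gt0.
have /nbhs_ballP[d /= d0 H] := C2_taylor x gC eK.
near=> t.
have tK : `|c t - x| <= K * `|t| by near: t.
have td : `|t| <= d / 2 / K by near: t; apply: near0_le; rewrite !divr_gt0.
have ctd : `|c t - x| < d.
  apply: le_lt_trans tK _; apply: le_lt_trans (ler_wpM2l (ltW K0) td) _.
  by rewrite mulrC divfK ?gt_eqF // ltr_pdivrMr // ltr_pMr // ltr1n.
have := H (c t - x); rewrite -ball_normE /= sub0r normrN => /(_ ctd).
rewrite subrKC -/G -/B => X.
have Y : `|g x + dot G (c t - x) + quad B (c t - x) -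
  (g x + dot G v * t + (quad B v + dot G w) * t ^+ 2)| <= e / 2 * t ^+ 2.
  by near: t; exact: J.
have doubling_gap : e / 2 / K ^+ 2 * `|c t - x| ^+ 2 <= e / 2 * t ^+ 2.
  apply: le_trans (_ : e / 2 / K ^+ 2 * (K * `|t|) ^+ 2 <= _).
    by rewrite ler_wpM2l ?(ltW eK) // lerXn2r ?nnegrE // mulr_ge0 // ltW.
  rewrite exprMn real_normK ?num_real // mulrA divfK //.
  by rewrite expf_neq0 // gt_eqF.
have -> : g (c t) - (g x + dot G v * t + (quad B v + dot G w) * t ^+ 2) =
  (g (c t) - (g x + dot G (c t - x) + quad B (c t - x))) +
  (g x + dot G (c t - x) + quad B (c t - x) -
  (g x + dot G v * t + (quad B v + dot G w) * t ^+ 2)) by ring.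
apply: le_trans (ler_normD _ _) _; lra.
Unshelve. all: by end_near. Qed.

End euclidean.

(** * Euclidean geometry, and tests on spheres and across planes *)

Section geometry.
Context {R : realType} {n : nat}.
Implicit Types (x y h v w e : 'rV[R]_n) (g : 'rV[R]_n -> R) (B : 'M[R]_n).

Lemma dotC x y : dot x y = dot y x.
Proof. by apply: eq_bigr => i _; rewrite mulrC. Qed.

Lemma dotDl x y v : dot (x + y) v = dot x v + dot y v.
Proof. by rewrite -big_split; apply: eq_bigr => i _; rewrite mxE mulrDl. Qed.

Lemma dotZl k x v : dot (k *: x) v = k * dot x v.
Proof. by rewrite mulr_sumr; apply: eq_bigr => i _; rewrite mxE mulrA. Qed.

Lemma dotNl x v : dot (- x) v = - dot x v.
Proof. by rewrite -scaleN1r dotZl mulN1r. Qed.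

Lemma dotDr x y v : dot v (x + y) = dot v x + dot v y.
Proof. by rewrite !(dotC v) dotDl. Qed.

Lemma dotZr k x v : dot v (k *: x) = k * dot v x.
Proof. by rewrite !(dotC v) dotZl. Qed.

Lemma dotNr x v : dot v (- x) = - dot v x.
Proof. by rewrite !(dotC v) dotNl. Qed.

Definition dotE := (dotDl, dotDr, dotNl, dotNr, dotZl, dotZr).

Lemma dot_basis x i : dot x (basis_vec i) = x 0 i.
Proof.
rewrite /dot (bigD1 i) //= big1 ?addr0 => [|j /negbTE ji].
  by rewrite mxE !eqxx mulr1.
by rewrite mxE ji andbF mulr0.
Qed.

Lemma enorm_ge0 x : 0 <= enorm x. Proof. exact: sqrtr_ge0. Qed.

Lemma dot_ge0 x : 0 <= dot x x.
Proof. by apply: sumr_ge0 => i _; rewrite -expr2 sqr_ge0. Qed.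

Lemma enorm_sqr x : enorm x ^+ 2 = dot x x.
Proof.
rewrite /enorm sqr_sqrtr; first by apply: eq_bigr => i _; rewrite expr2.
by apply: sumr_ge0 => i _; rewrite sqr_ge0.
Qed.

Lemma enormZ k x : enorm (k *: x) = `|k| * enorm x.
Proof.
apply/eqP; rewrite -(eqrXn2 (n := 2)) ?mulr_ge0 ?enorm_ge0 //.
by rewrite exprMn !enorm_sqr !dotE real_normK ?num_real // mulrA expr2.
Qed.

Lemma enorm0 : enorm (0 : 'rV[R]_n) = 0.
Proof. by rewrite -(scale0r 0) enormZ normr0 mul0r. Qed.

Lemma enorm0_eq0 x : enorm x = 0 -> x = 0.
Proof.
move=> x0; have : dot x x = 0 by rewrite -enorm_sqr x0 expr0n.
move=> /eqP; rewrite psumr_eq0 => [/allP h|i _]; last by rewrite -expr2 sqr_ge0.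
apply/rowP => i; have := h i; rewrite mem_index_enum => /(_ isT) /=.
by rewrite mulf_eq0 orbb mxE => /eqP.
Qed.

Lemma coord_le_enorm x i : `|x 0 i| <= enorm x.
Proof.
rewrite -sqrtr_sqr; apply: ler_wsqrtr; rewrite (bigD1 i) //= lerDl.
by apply: sumr_ge0 => j _; rewrite sqr_ge0.
Qed.

Lemma sup_norm_le_enorm x : `|x| <= enorm x.
Proof. by apply: sup_norm_le (enorm_ge0 x) _ => i; exact: coord_le_enorm. Qed.

(** Expand the square of the component of x orthogonal to e. *)
Lemma dot_unit_le x e : dot e e = 1 -> `|dot x e| <= enorm x.
Proof.
move=> e1; rewrite -(ler_pXn2r (n := 2)) ?nnegrE ?enorm_ge0 //.
rewrite real_normK ?num_real // enorm_sqr.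
have := dot_ge0 (x - dot x e *: e); rewrite !dotE e1 (dotC e x); nra.
Qed.

Lemma continuous_dotl v : continuous (fun x => dot x v).
Proof.
apply: continuous_big => [|i _ x]; first exact: add_continuous.
by apply: continuousM; [exact: coord_continuous | exact: cst_continuous].
Qed.

Lemma continuous_enorm : continuous (@enorm R n).
Proof.
move=> x; apply: (@continuous_comp _ _ _ _ Num.sqrt); last exact: sqrt_continuous.
apply: continuous_big => [|i _ y]; first exact: add_continuous.
by rewrite /prop_for /=; apply: continuousM; exact: coord_continuous.
Qed.

Lemma compact_enorm_ball r : compact [set x : 'rV[R]_n | enorm x <= r].
Proof.
apply: bounded_closed_compact.
  exists r; split; first exact: num_real.
  move=> M rM x /= xr; apply: le_trans (ltW rM).
  exact: le_trans (sup_norm_le_enorm x) xr.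
apply: (@preimage_closed _ _ (@enorm R n) [set s | s <= r] _ (@closed_le _ r)).
by move=> x _; exact: continuous_enorm.
Qed.

Lemma continuous_bounded_on_ball g r : continuous g ->
  exists2 C, 0 <= C & forall x, enorm x <= r -> g x <= C.
Proof.
move=> cg; have [r0|r0] := ltP r 0.
  by exists 0 => // x; rewrite leNgt (lt_le_trans r0) ?enorm_ge0.
have B0 : [set x : 'rV[R]_n | enorm x <= r] !=set0.
  by exists 0; rewrite /= enorm0.
have cgB : {within [set x : 'rV[R]_n | enorm x <= r], continuous g}.
  exact: continuous_subspaceT.
have [x _ hx] := compact_EVT_max B0 (@compact_enorm_ball r) cgB.
exists `|g x| => // y yr; apply: le_trans (ler_norm _).
by apply: hx; exact: mem_set.
Qed.

Lemma bilin_basis B i j : bilin B (basis_vec i) (basis_vec j) = B i j.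
Proof.
rewrite /bilin (bigD1 i) //= [X in _ + X]big1 => [|k /negbTE ki]; last first.
  by apply: big1 => l _; rewrite mxE ki andbF mul0r mulr0.
rewrite addr0 (bigD1 j) //= big1 => [|k /negbTE kj]; last first.
  by rewrite !mxE kj andbF !mulr0.
by rewrite !mxE !eqxx !mulr1 addr0.
Qed.

Lemma bilinDl B x y v : bilin B (x + y) v = bilin B x v + bilin B y v.
Proof.
rewrite -big_split; apply: eq_bigr => i _; rewrite -big_split.
by apply: eq_bigr => j _; rewrite mxE mulrDl mulrDr.
Qed.

Lemma bilinDr B x y v : bilin B v (x + y) = bilin B v x + bilin B v y.
Proof.
rewrite -big_split; apply: eq_bigr => i _; rewrite -big_split.
by apply: eq_bigr => j _; rewrite mxE !mulrDr.
Qed.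

Lemma bilinZl B k x v : bilin B (k *: x) v = k * bilin B x v.
Proof.
rewrite mulr_sumr; apply: eq_bigr => i _; rewrite mulr_sumr.
by apply: eq_bigr => j _; rewrite mxE; ring.
Qed.

Lemma bilinZr B k x v : bilin B v (k *: x) = k * bilin B v x.
Proof.
rewrite mulr_sumr; apply: eq_bigr => i _; rewrite mulr_sumr.
by apply: eq_bigr => j _; rewrite mxE; ring.
Qed.

Lemma bilinNl B x v : bilin B (- x) v = - bilin B x v.
Proof. by rewrite -scaleN1r bilinZl mulN1r. Qed.

Lemma bilinNr B x v : bilin B v (- x) = - bilin B v x.
Proof. by rewrite -scaleN1r bilinZr mulN1r. Qed.

Definition bilinE := (bilinDl, bilinDr, bilinNl, bilinNr, bilinZl, bilinZr).

Lemma sum_bilin_basisl B v w :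
  \sum_i v 0 i * bilin B (basis_vec i) w = bilin B v w.
Proof.
transitivity (bilin B (\sum_i v 0 i *: basis_vec i) w); last first.
  by congr (bilin _ _ _); apply/esym; exact: row_sum_delta.
elim/big_rec2: _ => [|i y1 y2 _ ->]; last by rewrite bilinDl bilinZl.
by apply/esym/big1 => i _; apply: big1 => j _; rewrite mxE mul0r mulr0.
Qed.

Lemma sum_bilin_basisr B v w :
  \sum_i w 0 i * bilin B v (basis_vec i) = bilin B v w.
Proof.
transitivity (bilin B v (\sum_i w 0 i *: basis_vec i)); last first.
  by congr (bilin _ _ _); apply/esym; exact: row_sum_delta.
elim/big_rec2: _ => [|i y1 y2 _ ->]; last by rewrite bilinDr bilinZr.
by apply/esym/big1 => i _; apply: big1 => j _; rewrite mxE mulr0 mulr0.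
Qed.

(** At a minimum over the sphere through x, rotate x in each coordinate plane
    (i, j) and add up the second order conditions.  The sum is |x|^2 times half
    the Laplacian of g on the sphere: Laplacian minus second radial derivative,
    minus (n - 1) / |x| times the first. *)
Lemma sphere_min_test g x : class_C 2 g ->
  (forall y, enorm y = enorm x -> g x <= g y) ->
  quad (half_hess g x) x + (n%:R - 1) / 2 * dot (grad g x) x <=
  dot x x * \tr (half_hess g x).
Proof.
move=> gC gmin; set B := half_hess g x; set G := grad g x.
have pair i j : 0 <= 2 * (x 0 i ^+ 2 * B j j - x 0 i * x 0 j * (B i j + B j i) +
    x 0 j ^+ 2 * B i i) -
    (1 - (i == j)%:R) * (x 0 i * G 0 i + x 0 j * G 0 j).
  have [<-|ij] := eqVneq i j.
    by rewrite subrr mul0r subr0 le_eqVlt; apply/orP; left; apply/eqP; ring.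
  pose v := x 0 i *: basis_vec j - x 0 j *: basis_vec i.
  pose p := x 0 i *: basis_vec i + x 0 j *: basis_vec j.
  (* s and 1 + k are the sine and cosine of the rotation, rationally
     parametrised so that their expansions are algebraic *)
  pose s (t : R) := 2 * t * (1 + t ^+ 2)^-1.
  pose k (t : R) := - 2 * t ^+ 2 * (1 + t ^+ 2)^-1.
  pose c t := x + s t *: v + k t *: p.
  have jV : jet2 (fun t : R => (1 + t ^+ 2)^-1) 1 0 (- 1).
    apply: jet2_ext (jet2V (jet2_ext _ _ _ _ (jet2_poly 1 0 1))) => // [||t].
    - by rewrite oppr0.
    - by rewrite expr0n sub0r.
    - by rewrite mul0r mul1r addr0.
  have js : jet2 s 0 2 0.
    by apply: jet2_ext (jet2M (jet2_poly 0 2 0) jV) => [t|||]; rewrite /s; ring.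
  have jk : jet2 k 0 0 (- 2).
    by apply: jet2_ext (jet2M (jet2_poly 0 0 (- 2)) jV) => [t|||]; rewrite /k; ring.
  have jc l : jet2 (fun t => c t 0 l) (x 0 l) ((2 *: v) 0 l) ((- 2 *: p) 0 l).
    apply: jet2_ext (jet2D (jet2D (jet2_cst (x 0 l)) (jet2Z (v 0 l) js))
      (jet2Z (p 0 l) jk)) => [t|||]; rewrite ?mxE; ring.
  have nij : (i == j) = false := negbTE ij.
  have nji : (j == i) = false by rewrite eq_sym.
  have be a b : (basis_vec a : 'rV[R]_n) 0 b = (b == a)%:R by rewrite mxE eqxx.
  have cn t : enorm (c t) = enorm x.
    rewrite /enorm; congr Num.sqrt.
    have E y : \sum_(i < n) y 0 i ^+ 2 = dot y y.
      by apply: eq_bigr => ? _; rewrite expr2.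
    rewrite !E /c /v /p !dotE !(dotC (basis_vec _) x) !dot_basis !be !eqxx nij nji.
    rewrite /s /k /=; field.
    by rewrite gt_eqF // ltr_pwDl // sqr_ge0.
  have [|_] := jet2_min (jet2_curve gC jc).
    by near=> t; apply: gmin; exact: cn.
  rewrite -/B -/G /quad /v /p !bilinE !bilin_basis !dotE !dot_basis /=.
  by rewrite subr0 mul1r; lra.
have : 0 <= \sum_i \sum_j (2 * (x 0 i ^+ 2 * B j j - x 0 i * x 0 j * (B i j + B j i) +
    x 0 j ^+ 2 * B i i) - (1 - (i == j)%:R) * (x 0 i * G 0 i + x 0 j * G 0 j)).
  by apply: sumr_ge0 => i _; apply: sumr_ge0 => j _; exact: pair.
have -> : \sum_i \sum_j (2 * (x 0 i ^+ 2 * B j j - x 0 i * x 0 j * (B i j + B j i) +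
    x 0 j ^+ 2 * B i i) - (1 - (i == j)%:R) * (x 0 i * G 0 i + x 0 j * G 0 j)) =
   4 * (dot x x * \tr B - quad B x) - 2 * (n%:R - 1) * dot G x.
  have S1 : \sum_i \sum_j x 0 i ^+ 2 * B j j = dot x x * \tr B.
    rewrite /dot mulr_suml; apply: eq_bigr => i _; rewrite -expr2.
    by rewrite -mulr_sumr.
  have S2 : \sum_i \sum_j x 0 j ^+ 2 * B i i = dot x x * \tr B.
    by rewrite exchange_big.
  have S3 : \sum_i \sum_j x 0 i * x 0 j * B i j = quad B x.
    by apply: eq_bigr => i _; apply: eq_bigr => j _; ring.
  have S4 : \sum_i \sum_j x 0 i * x 0 j * B j i = quad B x.
    by rewrite exchange_big; apply: eq_bigr => i _; apply: eq_bigr => j _; ring.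
  have S5 : \sum_(i < n) \sum_(j < n) x 0 i * G 0 i = n%:R * dot G x.
    rewrite /dot mulr_sumr; apply: eq_bigr => i _; rewrite sumr_const card_ord.
    by rewrite -mulr_natl mulrCA mulrC mulrA mulrC [x 0 i * _]mulrC; ring.
  have S6 : \sum_(i < n) \sum_(j < n) x 0 j * G 0 j = n%:R * dot G x.
    by rewrite exchange_big.
  have S7 : \sum_i \sum_j (i == j)%:R * (x 0 i * G 0 i + x 0 j * G 0 j) =
      2 * dot G x.
    rewrite /dot mulr_sumr; apply: eq_bigr => i _.
    rewrite (bigD1 i) //= big1 ?addr0 => [|j]; last first.
      by rewrite eq_sym => /negbTE ->; rewrite mul0r.
    by rewrite eqxx mul1r; ring.
  transitivity (2 * (\sum_i \sum_j x 0 i ^+ 2 * B j j) -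
     2 * (\sum_i \sum_j x 0 i * x 0 j * B i j) -
     2 * (\sum_i \sum_j x 0 i * x 0 j * B j i) +
     2 * (\sum_i \sum_j x 0 j ^+ 2 * B i i) -
     \sum_(i < n) \sum_(j < n) x 0 i * G 0 i - \sum_(i < n) \sum_(j < n) x 0 j * G 0 j
     + \sum_i \sum_j (i == j)%:R * (x 0 i * G 0 i + x 0 j * G 0 j)).
    rewrite !mulr_sumr -!sumrB -!big_split -!sumrB -!big_split /=.
    apply: eq_bigr => i _; rewrite !mulr_sumr -!sumrB -!big_split -!sumrB -!big_split /=.
    by apply: eq_bigr => j _; ring.
  by rewrite S1 S2 S3 S4 S5 S6 S7; ring.
lra.
Unshelve. all: by end_near. Qed.

Lemma class_C_opp k g : class_C k g -> class_C k (fun x => - g x).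
Proof.
elim: k g => [|k IH] g [cg H];
  (split; first by move=> x; exact: (continuousN (cg x))).
  by [].
move=> i; have [d c] := H i; split; first by move=> x; exact: derivableN.
rewrite (_ : partial i _ = (fun x => - partial i g x)); last first.
  by apply/funext => x; rewrite /partial deriveN.
exact: IH.
Qed.

Lemma partialN g i : (forall x, derivable g x (basis_vec i)) ->
  partial i (fun x => - g x) = (fun x => - partial i g x).
Proof. by move=> d; apply/funext => x; rewrite /partial deriveN. Qed.

Lemma gradN g x : class_C 1 g -> grad (fun x => - g x) x = - grad g x.
Proof.
move=> [_ gC]; rewrite grad.unlock; apply/rowP => i; rewrite !mxE.
by have [d _] := gC i; rewrite partialN.
Qed.

Lemma half_hessN g x : class_C 2 g ->
  half_hess (fun x => - g x) x = - half_hess g x.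
Proof.
move=> [_ gC]; rewrite half_hess.unlock; apply/matrixP => i j; rewrite !mxE.
have [d [_ c]] := gC i; have [d' _] := c j.
by rewrite partialN // partialN // mulrN.
Qed.

Lemma sphere_max_test g x : class_C 2 g ->
  (forall y, enorm y = enorm x -> g y <= g x) ->
  dot x x * \tr (half_hess g x) <=
  quad (half_hess g x) x + (n%:R - 1) / 2 * dot (grad g x) x.
Proof.
move=> gC gmax; have gC' := class_C_opp gC.
have := sphere_min_test gC' (x := x).
rewrite gradN ?half_hessN //; last exact: class_CW.
have -> : quad (- half_hess g x) x = - quad (half_hess g x) x.
  rewrite /quad /bilin -sumrN; apply: eq_bigr => i _; rewrite -sumrN.
  by apply: eq_bigr => j _; rewrite mxE mulNr.
rewrite dotNl raddfN /= => /(_ _) h.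
have {h} := h ltac:(by move=> y /gmax; rewrite lerN2).
lra.
Qed.

(** Reflection in the hyperplane x.e = l, for a unit vector e. *)
Definition mirror e (l : R) x := x - (2 * (dot x e - l)) *: e.

Lemma enorm_mirror e l x : dot e e = 1 ->
  enorm (mirror e l x) ^+ 2 = enorm x ^+ 2 - 4 * l * (dot x e - l).
Proof.
by move=> e1; rewrite !enorm_sqr /mirror !dotE e1 (dotC e x); ring.
Qed.

Lemma mirror_line e l x v t :
  mirror e l (x + t *: v) = mirror e l x + t *: mirror e 0 v.
Proof.
by rewrite /mirror !dotE; apply/rowP => i; rewrite !mxE; ring.
Qed.

(** The trace is invariant under the orthogonal map x -> mirror e 0 x; in
    particular reflections commute with the Laplacian. *)
Lemma quad_mirror_trace e B : dot e e = 1 ->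
  \sum_i quad B (mirror e 0 (basis_vec i)) = \tr B.
Proof.
move=> e1.
have E i : quad B (mirror e 0 (basis_vec i)) = B i i -
    2 * (e 0 i * bilin B (basis_vec i) e) - 2 * (e 0 i * bilin B e (basis_vec i))
    + 4 * (e 0 i * e 0 i) * quad B e.
  by rewrite /quad /mirror (dotC (basis_vec i) e) dot_basis subr0 !bilinE bilin_basis; ring.
rewrite (eq_bigr _ (fun i _ => E i)) !big_split /= !sumrN -!mulr_sumr.
rewrite sum_bilin_basisl sum_bilin_basisr -mulr_suml -mulr_sumr.
by rewrite -[\sum_(i < n) e 0 i * e 0 i]/(dot e e) e1 /quad /mxtrace; ring.
Qed.

Lemma jet2_line g x v : class_C 2 g ->
  jet2 (fun t => g (x + t *: v)) (g x) (dot (grad g x) v)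
    (quad (half_hess g x) v).
Proof.
move=> gC; have := @jet2_curve _ _ g x v 0 (fun t => x + t *: v) gC _.
rewrite (_ : dot (grad g x) 0 = 0) ?addr0; last first.
  by rewrite -(scale0r (0 : 'rV[R]_n)) dotZr mul0r.
apply=> i; apply: jet2_ext (jet2_poly (x 0 i) (v 0 i) 0) => [t|||]; rewrite ?mxE //.
ring.
Qed.

(** Second order condition at a point where w = g - g o mirror touches from
    above the multiple z of the barrier 2 - 1 / (1 + A (y.e - l)).  The left
    side of the conclusion is half the Laplacian of that multiple. *)
Lemma plane_test g e l x A z : class_C 2 g -> dot e e = 1 -> 0 <= A ->
  l < dot x e ->
  (forall y, l < dot y e ->
     z * (2 - (1 + A * (dot y e - l))^-1) <= g y - g (mirror e l y)) ->
  g x - g (mirror e l x) = z * (2 - (1 + A * (dot x e - l))^-1) ->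
  - (z * A ^+ 2 / (1 + A * (dot x e - l)) ^+ 3) <=
    \tr (half_hess g x) - \tr (half_hess g (mirror e l x)).
Proof.
move=> gC e1 A0 lx hge heq; set q := 1 + A * (dot x e - l).
have q0 : 0 < q by rewrite /q ltr_pwDl // mulr_ge0 // subr_ge0 ltW.
have H i : 0 <= quad (half_hess g x) (basis_vec i) -
    quad (half_hess g (mirror e l x)) (mirror e 0 (basis_vec i)) +
    z * (A ^+ 2 * (e 0 i * e 0 i) / q ^+ 3).
  have J1 := jet2_line x (basis_vec i) gC.
  have J2 := jet2_line (mirror e l x) (mirror e 0 (basis_vec i)) gC.
  have JV := jet2Z q^-1 (jet2V (jet2_poly 1 (A * e 0 i / q) 0)).
  have := jet2D (jet2D J1 (jet2Z (- 1) J2))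
    (jet2Z (- z) (jet2D (jet2_cst 2) (jet2Z (- 1) JV))).
  move=> /jet2_min [|_].
    have : \forall t \near (0 : R), l < dot (x + t *: basis_vec i) e.
      have : (fun t : R => dot (x + t *: basis_vec i) e) @ 0 -->
          dot (x + 0 *: basis_vec i) e.
        apply: (@continuous_comp _ _ _ (fun t : R => x + t *: basis_vec i)
          (fun y => dot y e)); last exact: continuous_dotl.
        by apply: cvgD; [exact: cvg_cst | apply: cvgZl; exact: cvg_id].
      by rewrite scale0r addr0 => /cvgr_gt; apply.
    apply: filterS => t lt; have := hge _ lt.
    rewrite mirror_line !dotE (dotC (basis_vec i)) dot_basis.
    rewrite -/q (_ : 1 + A * _ = q * (1 + A * e 0 i / q * t + 0 * t ^+ 2)).
      rewrite invfM; move: heq; rewrite -/q; lra.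
    by rewrite /q; field; rewrite -/q gt_eqF.
  move/le_trans; apply; rewrite le_eqVlt; apply/orP; left; apply/eqP.
  by field; rewrite gt_eqF.
have : 0 <= \sum_i (quad (half_hess g x) (basis_vec i) -
    quad (half_hess g (mirror e l x)) (mirror e 0 (basis_vec i)) +
    z * (A ^+ 2 * (e 0 i * e 0 i) / q ^+ 3)).
  by apply: sumr_ge0 => i _; exact: H.
have tr0 : \sum_i quad (half_hess g x) (basis_vec i) = \tr (half_hess g x).
  by apply: eq_bigr => i _; exact: bilin_basis.
have -> : \sum_i (quad (half_hess g x) (basis_vec i) -
    quad (half_hess g (mirror e l x)) (mirror e 0 (basis_vec i)) +
    z * (A ^+ 2 * (e 0 i * e 0 i) / q ^+ 3)) =
  \tr (half_hess g x) - \tr (half_hess g (mirror e l x)) +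
    z * (A ^+ 2 * dot e e / q ^+ 3).
  rewrite !big_split /= sumrN quad_mirror_trace // tr0; congr (_ + _).
  by rewrite -mulr_sumr -mulr_suml -mulr_sumr.
by rewrite e1; lra.
Qed.

End geometry.

(** * Moving planes *)

Section moving_planes.
Context {R : realType} {n : nat}.
Variables (u rho : 'rV[R]_n -> R) (f : R -> R) (R0 : R) (e : 'rV[R]_n).
Hypothesis u_C2 : class_C 2 u.
Hypothesis u_eq : forall x, \tr (half_hess u x) = rho x * f (u x) / 2.
Hypothesis u_gt0 : forall x, 0 < u x.
Hypothesis f_gt0 : forall t, 0 < t -> 0 < f t.
Hypothesis rho_gt0 : forall x, 0 < rho x.
Hypothesis rho_decr : forall x y, enorm x < enorm y -> rho y < rho x.
Hypothesis f_mono : forall x y,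
  R0 <= enorm x -> u x < u y -> f (u x) <= f (u y).
Hypothesis f_lip : forall K, exists2 L, 0 <= L &
  forall p q, 0 < p <= K -> 0 < q <= K -> `|f p - f q| <= L * `|p - q|.
Hypothesis u_far : forall eps, 0 < eps -> exists r, forall x y,
  r < enorm x -> enorm x < enorm y -> u x <= u y + eps.
Hypothesis e1 : dot e e = 1.

Let cu : continuous u. Proof. by case: u_C2. Qed.

Definition plane_le l := forall x, l < dot x e -> u (mirror e l x) <= u x.

Lemma cvg_mirror (T : Type) (F : set_system T) (FF : Filter F)
    (p : T -> 'rV[R]_n) (l : T -> R) x l0 : p @ F --> x -> l @ F --> l0 ->
  (fun t => mirror e (l t) (p t)) @ F --> mirror e l0 x.
Proof.
move=> px ll; apply: cvgB => //; apply: cvgZl; apply: cvgMr; apply: cvgB => //.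
exact: (cvg_comp _ _ px (@continuous_dotl _ _ e x)).
Qed.

Lemma enorm_mirror_lt l x : 0 < l -> l < dot x e ->
  enorm (mirror e l x) < enorm x.
Proof.
move=> l0 lx; rewrite -(ltr_pXn2r (n := 2)) ?nnegrE ?enorm_ge0 //.
have := enorm_mirror l x e1; nra.
Qed.

Lemma dot_le_enorm x : dot x e <= enorm x.
Proof. by rewrite (le_trans (ler_norm _)) // dot_unit_le. Qed.

(** Points x far away have far mirror images, as |x'|^2 >= |x| (|x| - 4 l), and
    |x'| < |x|; so u at infinity compares u(x') with u(x). *)
Lemma mirror_far l eps : 0 < l -> 0 < eps -> exists r, forall x,
  l < dot x e -> r < enorm x -> - eps <= u x - u (mirror e l x).
Proof.
move=> l0 eps0; have [r hr] := u_far eps0.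
exists (4 * l + `|r| + 1) => x lx rx.
have := hr (mirror e l x) x; rewrite enorm_mirror_lt // => /(_ _ isT) h.
suff /h : r < enorm (mirror e l x) by lra.
apply: le_lt_trans (ler_norm r) _.
rewrite -(ltr_pXn2r (n := 2)) ?nnegrE ?enorm_ge0 // enorm_mirror //.
have := dot_le_enorm x; have := normr_ge0 r; nra.
Qed.

(** Bounded, so that its multiples do not affect the behaviour at infinity, and
    concave in the distance to the plane, with second derivative of order A^2
    within distance 1 / A. *)
Definition barrier A l (x : 'rV[R]_n) : R := 2 - (1 + A * (dot x e - l))^-1.

Lemma barrier_bounds A l x : 0 <= A -> l <= dot x e -> 1 <= barrier A l x <= 2.
Proof.
move=> A0 lx; rewrite /barrier; set q := 1 + _.
have q1 : 1 <= q by rewrite /q lerDl mulr_ge0 // subr_ge0.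
have : 0 < q^-1 by rewrite invr_gt0; lra.
have : q^-1 <= 1 by rewrite invf_le1 //; lra.
by lra.
Qed.

(** The quotient of w = u - u o mirror by the barrier has a minimum as soon as it
    is negative somewhere: w is almost nonnegative at infinity and vanishes on
    the plane. *)
Lemma negative_quotient_min A l x1 : 0 <= A -> 0 < l -> l < dot x1 e ->
  u x1 < u (mirror e l x1) ->
  exists x0 z, [/\ z < 0, l < dot x0 e,
    u x0 - u (mirror e l x0) = z * barrier A l x0 &
    forall y, l < dot y e -> z * barrier A l y <= u y - u (mirror e l y)].
Proof.
move=> A0 l0 lx1 ux1.
pose w y := u y - u (mirror e l y); pose Q y := w y / barrier A l y.
have w1 : w x1 < 0 by rewrite subr_lt0.
have barrier_gt0 y : l <= dot y e -> 0 < barrier A l y.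
  by move=> /(barrier_bounds A0) /andP[]; lra.
have Q1 : Q x1 < 0 by rewrite /Q pmulr_llt0 // invr_gt0 barrier_gt0 // ltW.
have Q1' : 0 < - Q x1 by rewrite oppr_gt0.
have [r hr] := mirror_far l0 Q1'.
pose K := [set y | enorm y <= Num.max r (enorm x1)] `&` [set y | l <= dot y e].
have cK : compact K.
  apply: compact_closedI; first exact: compact_enorm_ball.
  apply: (@preimage_closed _ _ (fun y => dot y e) [set s | l <= s] _ (@closed_ge _ l)).
  by move=> x _; exact: continuous_dotl.
have K1 : K x1 by split => /=; [rewrite le_max lexx orbT | exact: ltW].
have cQy (y : 'rV[R]_n) (F : set_system 'rV[R]_n) (FF : Filter F) :
    l <= dot y e -> id @ F --> y -> Q @ F --> Q y.
  move=> ly Fy; apply: cvgM.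
    rewrite /w; apply: cvgB.
      by apply: (@cvg_comp _ _ _ id u F (nbhs y)) => //; exact: cu.
    apply: (@cvg_comp _ _ _ (mirror e l) u F (nbhs (mirror e l y)));
      last exact: cu.
    by apply: cvg_mirror; [exact: Fy | exact: cvg_cst].
  apply: cvgV; first by rewrite gt_eqF // barrier_gt0.
  rewrite /barrier; apply: cvgB; first exact: cvg_cst.
  apply: cvgV; first by rewrite gt_eqF // ltr_pwDl // mulr_ge0 // subr_ge0.
  apply: cvgD; first exact: cvg_cst.
  apply: cvgMr; apply: cvgB; last exact: cvg_cst.
  apply: (@cvg_comp _ _ _ id (fun y => dot y e) F (nbhs y)) => //.
  exact: continuous_dotl.
have cQ : {within K, continuous Q}.
  apply: continuous_in_subspaceT => y /set_mem[_ ly].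
  exact: (cQy y (nbhs y) _ ly cvg_id).
have [x0 /set_mem[_ /= lx0] hmin] := compact_EVT_min (ex_intro _ _ K1) cK cQ.
have Q0 : Q x0 <= Q x1 by apply: hmin; exact: mem_set.
have wE y : l <= dot y e -> w y = Q y * barrier A l y.
  by move=> ly; rewrite /Q divfK // gt_eqF // barrier_gt0.
exists x0, (Q x0); split; first exact: le_lt_trans Q1.
- rewrite lt_neqAle lx0 andbT; apply/negP => /eqP lE.
  have : w x0 = 0 by rewrite /w /mirror -lE subrr mulr0 scale0r subr0 subrr.
  by move=> w0; move: Q0; rewrite /Q w0 mul0r leNgt Q1.
- exact: wE.
- move=> y ly; have ly' := ltW ly; have /andP[p1 p2] := barrier_bounds A0 ly'.
  have [yr|yr] := leP (enorm y) (Num.max r (enorm x1)).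
    rewrite -/(w y) wE // ler_wpM2r ?hmin //; first by lra.
    by apply: mem_set; split.
  have := hr y ly; rewrite opprK => /(_ _) h.
  have : r < enorm y by apply: le_lt_trans yr; rewrite le_max lexx.
  move=> /h; rewrite -/(w y); nra.
Qed.

(** At an interior zero of w >= 0 one would have Lap w >= 0, while
    Lap w = (rho(x) - rho(x')) f(u(x)) < 0. *)
Lemma plane_le_strict l x : 0 < l -> plane_le l -> l < dot x e ->
  u (mirror e l x) < u x.
Proof.
move=> l0 Pl lx; rewrite lt_neqAle Pl // andbT; apply/negP => /eqP E.
have := @plane_test _ _ u e l x 0 0 u_C2 e1 (lexx 0) lx.
rewrite !mul0r oppr0 E subrr => /(_ _ erefl) h.
have {h} : 0 <= \tr (half_hess u x) - \tr (half_hess u (mirror e l x)).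
  by apply: h => y ly; rewrite mul0r subr_ge0 Pl.
rewrite !u_eq E.
have := rho_decr (enorm_mirror_lt l0 lx); have := f_gt0 (u_gt0 x).
nra.
Qed.

(** With A large compared with the Lipschitz constant of f, the inequality
    w >= 0 only has to be known in the bounded region at distance more than
    1 / A from the plane. *)
Lemma plane_step : exists2 A, 0 < A & forall l, 0 < l ->
  (forall x, A^-1 < dot x e - l -> enorm x <= R0 -> u (mirror e l x) <= u x) ->
  plane_le l.
Proof.
have [K _ hK] := continuous_bounded_on_ball R0 cu.
have [L L0 hL] := f_lip K.
(* near the plane the test gives |z| A / 8 <= rho(0) L |z| *)
pose A := 8 * rho 0 * L + 1; exists A.
  by rewrite /A ltr_wpDl // !mulr_ge0 // ltW.
have A1 : 1 <= A by rewrite /A lerDr !mulr_ge0 // ltW.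
have A0 : 0 < A by lra.
move=> l l0 wide x1 lx1; rewrite leNgt; apply/negP => ux1.
have [x [z [z0 lx wx hz]]] := negative_quotient_min (ltW A0) l0 lx1 ux1.
have := plane_test u_C2 e1 (ltW A0) lx hz wx.
have /andP[p1 p2] := barrier_bounds (ltW A0) (ltW lx).
have xx' := enorm_mirror_lt l0 lx.
have uu' : u x < u (mirror e l x) by rewrite -subr_lt0 wx; nra.
have ru := rho_decr xx'.
have f1 := f_gt0 (u_gt0 x); have f2 := f_gt0 (u_gt0 (mirror e l x)).
have r1 := rho_gt0 x.
rewrite !u_eq; set q := 1 + A * _; apply/negP; rewrite -ltNge.
have q0 : 0 < q by rewrite /q ltr_pwDl // mulr_ge0 ?ltW // subr_gt0.
have lhs : 0 < - (z * A ^+ 2 / q ^+ 3).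
  by rewrite -!mulNr divr_gt0 ?exprn_gt0 // mulr_gt0 ?oppr_gt0 // exprn_gt0.
have [R0x|R0x] := leP R0 (enorm x).
  apply: lt_trans lhs; have := f_mono R0x uu'; nra.
(* x lies in the ball, hence near the plane *)
have narrow : dot x e - l <= A^-1.
  rewrite leNgt; apply/negP => h.
  by have := wide x h (ltW R0x); rewrite leNgt uu'.
have q2 : q <= 2.
  have : A * (dot x e - l) <= 1 by rewrite mulrC -ler_pdivlMr // mul1r.
  by rewrite /q; lra.
have q8 : q ^+ 3 <= 8.
  have -> : 8 = 2 ^+ 3 :> R by ring.
  by rewrite lerXn2r ?nnegrE // ltW.
have lhs8 : - z * A / 8 <= - (z * A ^+ 2 / q ^+ 3).
  rewrite -!mulNr ler_pM ?invr_ge0 ?mulr_ge0 ?oppr_ge0 ?(ltW z0) ?(ltW A0) //.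
    by rewrite ler_wpM2l ?oppr_ge0 ?(ltW z0) // expr2 ler_peMl // ltW.
  by rewrite lef_pV2 ?posrE ?exprn_gt0.
have rho0 : rho x <= rho 0.
  have [x0|x0] := leP (enorm x) 0.
    have /enorm0_eq0 -> // : enorm x = 0.
    by apply/eqP; rewrite eq_le x0 enorm_ge0.
  by apply/ltW/rho_decr; rewrite enorm0.
have lip : f (u x) - f (u (mirror e l x)) <= L * (- z * 2).
  apply: le_trans (ler_norm _) _; apply: le_trans (hL _ _ _ _) _.
  - by rewrite u_gt0 hK // ltW.
  - by rewrite u_gt0 hK // ltW // (lt_trans xx').
  - rewrite wx normrM (ltr0_norm z0) (ger0_norm (le_trans ler01 p1)).
    by rewrite !ler_wpM2l // oppr_ge0 ltW.
have main : rho x * f (u x) / 2 - rho (mirror e l x) * f (u (mirror e l x)) / 2 <=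
    rho 0 * (L * - z).
  have s1 : rho x * (f (u x) - f (u (mirror e l x))) <= rho 0 * (L * (- z * 2)).
    apply: le_trans (ler_wpM2l (ltW r1) lip) _.
    by rewrite ler_wpM2r // !mulr_ge0 // oppr_ge0 ltW.
  have s2 : rho x * f (u (mirror e l x)) <= rho (mirror e l x) * f (u (mirror e l x)).
    by rewrite ler_wpM2r // ltW.
  lra.
apply: le_lt_trans main _; apply: lt_le_trans lhs8.
rewrite /A; nra.
Qed.

Lemma plane_le_right l : 0 <= l ->
  (forall l', l < l' -> plane_le l') -> plane_le l.
Proof.
move=> l0 h x lx.
have c : (fun l' => u x - u (mirror e l' x)) @ l --> u x - u (mirror e l x).
  apply: cvgB; first exact: cvg_cst.
  apply: (@cvg_comp _ _ _ (fun l' => mirror e l' x) u (nbhs l)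
    (nbhs (mirror e l x))); last exact: cu.
  by apply: cvg_mirror; [exact: cvg_cst | exact: cvg_id].
rewrite -subr_ge0 leNgt; apply/negP => neg.
have /nbhs_ballP[d /= d0 H] : \forall l' \near l, u x - u (mirror e l' x) < 0.
  by apply: cvgr_lt c _ neg.
pose s := Num.min (d / 2) ((dot x e - l) / 2).
have s0 : 0 < s by rewrite lt_min !divr_gt0 // subr_gt0.
have sd : s < d by rewrite gt_min; apply/orP; left; lra.
have sx : s < dot x e - l.
  rewrite gt_min; apply/orP; right.
  by rewrite ltr_pdivrMr // ltr_pMr ?ltr1n // subr_gt0.
have := H (l + s); rewrite -ball_normE /= opprD addNKr normrN gtr0_norm // => /(_ sd).
rewrite subr_lt0 ltNge h //; lra.
Qed.

(** On the compact set at distance at least 1 / (2 A) from the plane, w > 0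
    persists for nearby planes; [plane_step] covers the rest. *)
Lemma plane_le_left l : 0 < l -> plane_le l ->
  exists2 d, 0 < d & forall l', 0 < l' -> l - d < l' -> l' <= l -> plane_le l'.
Proof.
move=> l0 Pl; have [A A0 step] := plane_step.
have iA : 0 < A^-1 by rewrite invr_gt0.
pose K := [set x : 'rV[R]_n | enorm x <= R0] `&`
  [set x | l + A^-1 / 2 <= dot x e].
have cK : compact K.
  apply: compact_closedI; first exact: compact_enorm_ball.
  apply: (@preimage_closed _ _ (fun y => dot y e) [set s | _ <= s] _ (@closed_ge _ _)).
  by move=> x _; exact: continuous_dotl.
have /compact_near_coveringP cov := cK.
have : \forall l' \near l, K `<=` (fun x => 0 < u x - u (mirror e l' x)).
  apply: (cov R (nbhs l) (fun l' x => 0 < u x - u (mirror e l' x))) => x [/= _ lx].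
  have c : (fun p : 'rV[R]_n * R => u p.1 - u (mirror e p.2 p.1)) @ (x, l) -->
      u x - u (mirror e l x).
    apply: cvgB.
      apply: (@cvg_comp _ _ _ fst u (nbhs (x, l)) (nbhs x)); last exact: cu.
      exact: cvg_fst.
    apply: (@cvg_comp _ _ _ (fun p : 'rV[R]_n * R => mirror e p.2 p.1) u
      (nbhs (x, l)) (nbhs (mirror e l x))); last exact: cu.
    by apply: cvg_mirror; [exact: cvg_fst | exact: cvg_snd].
  have pos : 0 < u x - u (mirror e l x).
    by rewrite subr_gt0 plane_le_strict //; lra.
  exact: (cvgr_gt _ c _ pos).
move=> /nbhs_ballP[d /= d0 H].
exists (Num.min d (A^-1 / 2)); first by rewrite lt_min d0 divr_gt0.
move=> l' l'0 dl ll; apply: step => // x wide xR.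
have d1 : l - d < l'.
  by apply: le_lt_trans dl; rewrite lerD2l lerN2 ge_min lexx.
have d2 : l - A^-1 / 2 < l'.
  by apply: le_lt_trans dl; rewrite lerD2l lerN2 ge_min lexx orbT.
have := H l' _ x _; rewrite subr_gt0 => h; apply/ltW/h.
  by rewrite -ball_normE /= ger0_norm; lra.
by split => //=; lra.
Qed.

Theorem plane_le0 : plane_le 0.
Proof.
apply: plane_le_right => // l0 l0_gt0; apply: contrapT => nP.
have [A A0 step] := plane_step.
have far l : 0 < l -> R0 <= l -> plane_le l.
  move=> lgt0 Rl; apply: step => // x wide xR.
  have : 0 < A^-1 by rewrite invr_gt0.
  have := dot_le_enorm x; lra.
pose S := [set l | l0 <= l /\ ~ plane_le l].
have Sub : ubound S (Num.max l0 R0).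
  move=> l [l0l nPl]; rewrite leNgt gt_max; apply/negP => /andP[_ h].
  by apply: nPl; apply: far; [exact: lt_le_trans l0l | exact: ltW].
have S0 : S l0 by split.
have supS : has_sup S by split; [exists l0 | exists (Num.max l0 R0)].
have l0s : l0 <= sup S by apply: ub_le_sup => //; exact: supS.2.
have s0 : 0 < sup S := lt_le_trans l0_gt0 l0s.
have Pright l : sup S < l -> plane_le l.
  move=> sl; apply: contrapT => nPl.
  have : l <= sup S.
    apply: ub_le_sup; first exact: supS.2.
    by split => //; exact: le_trans (ltW sl).
  by rewrite leNgt sl.
have Ps : plane_le (sup S) by apply: plane_le_right => //; exact: ltW.
have [d d0 hd] := plane_le_left s0 Ps.
have [l [l0l nPl] sl] := sup_adherent d0 supS.
apply: (nPl); apply: hd => //; first exact: lt_le_trans l0l.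
apply: ub_le_sup; first exact: supS.2.
by split.
Qed.

End moving_planes.

(** * Solutions tending to infinity are almost monotone at infinity *)

(** With |x| = s^(-N), both the scaling factor of the motion s -> s + t and the
    harmonic function |x|^(2-n) = s^(N (n - 2)) are powers. *)
Lemma jet2X (R : realType) (phi : R -> R) (a b : R) (N : nat) :
  jet2 phi 1 a b ->
  jet2 (fun t => phi t ^+ N) 1 (N%:R * a)
    (N%:R * b + N%:R * (N%:R - 1) / 2 * a ^+ 2).
Proof.
move=> h; elim: N => [|N IH].
  by apply: jet2_ext (jet2_cst 1) => // [|]; rewrite ?mul0r ?add0r ?mul0r.
apply: jet2_ext (jet2M h IH) => [t|||].
- by rewrite exprS.
- by rewrite mulr1.
- by rewrite -natr1; ring.
- by rewrite -natr1; field.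
Qed.

(** Combination of the conditions at the maximum of the doubled functional.  Here
    |x| = s^(-nu), |y| = s'^(-nu), P and Q are the first and second order radial
    Taylor coefficients of u at x, T is |x|^2 times half the Laplacian there,
    primes refer to y, and h is the value of the harmonic term.  The
    contributions of h cancel because s^(nu k) is harmonic. *)
Lemma radial_algebra (R : realType) (s s' nu k h P Q T P' Q' T' : R) :
  0 < s' -> s' < s -> 1 <= nu -> 1 <= k -> 0 <= P' ->
  - (nu / s * P) + nu / s' * P' - h * (nu * k / s) = 0 ->
  (nu / s) ^+ 2 * Q + nu * (nu + 1) / 2 / s ^+ 2 * P
    - ((nu / s') ^+ 2 * Q' + nu * (nu + 1) / 2 / s' ^+ 2 * P')
    - h * (nu * k * (nu * k - 1) / 2 / s ^+ 2) <= 0 ->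
  T <= Q + (k + 1) / 2 * P -> Q' + (k + 1) / 2 * P' <= T' ->
  T / s ^+ 2 <= T' / s' ^+ 2.
Proof.
move=> s'0 ss' nu1 k1 P'0.
have s0 : 0 < s := lt_trans s'0 ss'.
set a := s^-1; set b := s'^-1.
have a0 : 0 < a by rewrite invr_gt0.
have ab : a < b by rewrite ltf_pV2 ?posrE.
rewrite -!exprVn !exprMn -/a -/b => E1 E2 S1 S2.
have mu1 : 0 <= nu * k - 1 by nra.
have nu0 : 0 < nu by lra.
have n2 : 0 < nu ^+ 2 by rewrite exprn_gt0.
rewrite -(ler_pM2l n2).
have a2 : 0 <= nu ^+ 2 * a ^+ 2 by rewrite mulr_ge0 // sqr_ge0.
have b2 : 0 <= nu ^+ 2 * b ^+ 2 by rewrite mulr_ge0 // sqr_ge0.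
have S1' := ler_wpM2l a2 S1; have S2' := ler_wpM2l b2 S2.
have E1' : nu * a * P = nu * b * P' - h * (nu * k) * a by lra.
have E3 : (nu * k - 1) / 2 * a * (nu * a * P) =
   (nu * k - 1) / 2 * a * (nu * b * P' - h * (nu * k) * a) by rewrite E1'.
have X : 0 <= (nu * k - 1) * (nu * P') * b * (b - a).
  by rewrite !mulr_ge0 // ?subr_ge0 ?ltW // invr_gt0.
lra.
Qed.

Lemma exists_root_inv (R : realType) (r : R) (N : nat) : (0 < N)%N -> 0 < r ->
  exists2 s, 0 < s & r * s ^+ N = 1.
Proof.
move=> N0 r0; exists (r `^ (- N%:R^-1)); first exact: powR_gt0.
rewrite -powR_mulrn ?powR_ge0 // -powRrM mulNr mulVf ?pnatr_eq0 -?lt0n //.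
by rewrite powR_inv1 ?ltW // divff // gt_eqF.
Qed.

Lemma inv_pow_le (R : realType) (r s t : R) (N : nat) : r * s ^+ N = 1 ->
  0 < t -> t <= s -> r <= t ^- N.
Proof.
move=> rs t0 ts; have s0 : 0 < s := lt_le_trans t0 ts.
have sN : 0 < s ^+ N by rewrite exprn_gt0.
rewrite -[leLHS](mulfK (_ : s ^+ N != 0)) ?gt_eqF // rs mul1r.
by rewrite lef_pV2 ?posrE ?exprn_gt0 // lerXn2r ?nnegrE // ltW.
Qed.

Section large_solutions.
Context {R : realType} {n : nat}.
Hypothesis n3 : (3 <= n)%N.
Variables (u rho : 'rV[R]_n -> R) (f : R -> R) (M alpha : R).
Hypothesis u_C2 : class_C 2 u.
Hypothesis u_eq : forall x, \tr (half_hess u x) = rho x * f (u x) / 2.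
Hypothesis u_gt0 : forall x, 0 < u x.
Hypothesis f_gt0 : forall t, 0 < t -> 0 < f t.
Hypothesis f_mono : forall s t, M <= s -> s <= t -> f s <= f t.
Hypothesis alpha2 : 2 < alpha.
Hypothesis rho_powR : forall x, 1 <= enorm x -> rho x = enorm x `^ (- alpha).
Hypothesis u_large : forall A, exists r, forall x, r < enorm x -> A < u x.

Let cu : continuous u. Proof. by case: u_C2. Qed.

(** The coefficient of f in the equation written in the variable s. *)
Lemma weight_powR (N : nat) x s : 0 < s -> enorm x * s ^+ N = 1 -> 1 <= enorm x ->
  enorm x ^+ 2 * rho x / s ^+ 2 = s `^ (N%:R * (alpha - 2) - 2).
Proof.
move=> s0 xs x1; rewrite rho_powR //.
have -> : enorm x = s `^ (- N%:R).
  by rewrite powR_invn ?ltW // -[LHS](mulfK (_ : s ^+ N != 0)) ?xs ?mul1r //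
    expf_neq0 // gt_eqF.
have -> : s ^+ 2 = (s `^ (-2))^-1.
  by rewrite (powR_invn 2) ?ltW // invrK.
rewrite invrK -powR_mulrn ?powR_ge0 // -!powRrM.
have sp r t : s `^ r * s `^ t = s `^ (r + t).
  by rewrite powRD //; apply/implyP => _; rewrite gt_eqF.
by rewrite !sp; congr (_ `^ _); ring.
Qed.

Section doubling.
Variables (N : nat) (s0 C0 eta : R).
Hypothesis N0 : (0 < N)%N.
Hypothesis N_alpha : 2 < N%:R * (alpha - 2).
Hypothesis s0_gt0 : 0 < s0.
Hypothesis s0_le1 : s0 <= 1.
Hypothesis C0_ge0 : 0 <= C0.
Hypothesis eta0 : 0 < eta.
Hypothesis C0_bound : forall x, enorm x * s0 ^+ N <= 1 -> u x <= C0.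
Hypothesis large0 : forall x s, 0 < s -> s <= s0 -> enorm x * s ^+ N = 1 ->
  1 <= enorm x /\ M <= u x.

Let m := (N * (n - 2))%N.

(** s and s' stand for |x|^(-1/N) and |y|^(-1/N); the inequality s' + eta <= s
    says that y lies beyond the translate by eta of the sphere of x.  Keeping it
    an inequality lets y move outwards freely. *)
Definition shifted_pair (x y : 'rV[R]_n) (s s' : R) :=
  [/\ 0 < s', s' + eta <= s, s <= s0,
  enorm x * s ^+ N = 1 & enorm y * s' ^+ N = 1].

(** The last term is the harmonic function equal to C0 for s = s0. *)
Definition doubling_gap (x y : 'rV[R]_n) (s : R) :=
  u x - u y - C0 * (s / s0) ^+ m.

(** Since s >= eta, x stays in a bounded set, where u is bounded; as y tends to
    infinity u(y) does too and the gap becomes negative. *)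
Lemma doubling_max x1 y1 s1 s1' :
  shifted_pair x1 y1 s1 s1' -> 0 < doubling_gap x1 y1 s1 ->
  exists x y s s', [/\ shifted_pair x y s s', 0 < doubling_gap x y s &
    forall x2 y2 s2 s2', shifted_pair x2 y2 s2 s2' ->
      doubling_gap x2 y2 s2 <= doubling_gap x y s].
Proof.
move=> pair1 Z1.
have [B B0 hB] := continuous_bounded_on_ball (eta ^- N) cu.
have [r1 hr1] := u_large B.
pose sig := (1 + `|r1|)^-1.
have sig0 : 0 < sig by rewrite invr_gt0 ltr_pwDl.
have small x y s s' : shifted_pair x y s s' -> enorm x <= eta ^- N.
  by move=> [s'0 ss' _ xs _]; apply: inv_pow_le xs _ _ => //; lra.
have far x y s s' : shifted_pair x y s s' -> s' < sig -> doubling_gap x y s < 0.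
  move=> a s'sig; have xB := hB _ (small _ _ _ _ a).
  case: a => s'0 ss' ss0 xs ys.
  have s'1 : s' <= 1 by have := s0_le1; have := eta0; lra.
  have s'N : 0 < s' ^+ N by rewrite exprn_gt0.
  have : r1 < enorm y.
    apply: le_lt_trans (ler_norm r1) _.
    have -> : enorm y = s' ^- N.
      by rewrite -[LHS](mulfK (_ : s' ^+ N != 0)) ?gt_eqF // ys mul1r.
    apply: lt_le_trans (_ : s'^-1 <= _).
      have : (1 + `|r1|) < s'^-1 by rewrite -ltf_pV2 ?posrE ?invr_gt0 ?ltr_pwDl // invrK.
      by lra.
    by rewrite lef_pV2 ?posrE // -[leRHS]expr1 ler_wiXn2l // ltW.
  move=> /hr1; rewrite /doubling_gap.
  have : 0 <= C0 * (s / s0) ^+ m.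
    by rewrite mulr_ge0 // exprn_ge0 // divr_ge0 // ?(ltW s0_gt0) //; have := eta0; lra.
  lra.
pose K : set (('rV[R]_n * 'rV[R]_n) * (R * R)) :=
  (([set x | enorm x <= eta ^- N] `*` [set y | enorm y <= sig ^- N]) `*`
   (`[0, s0] `*` `[sig, s0])) `&`
  ([set p | p.2.2 + eta - p.2.1 <= 0] `&`
   ([set p | enorm p.1.1 * p.2.1 ^+ N = 1] `&`
    [set p | enorm p.1.2 * p.2.2 ^+ N = 1])).
have Kpair p : K p -> shifted_pair p.1.1 p.1.2 p.2.1 p.2.2.
  move=> [[_ [/=]]]; rewrite !in_itv /= => /andP[_ ss0] /andP[sg _] [es [xs ys]].
  by split => //; have := sig0; lra.
have pairK x y s s' : shifted_pair x y s s' -> sig <= s' -> K ((x, y), (s, s')).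
  move=> a sg; have xB := small _ _ _ _ a; case: a => s'0 ss' ss0 xs ys.
  split; first split; split => //=.
  - by apply: inv_pow_le ys _ _.
  - by rewrite in_itv /=; apply/andP; split => //; have := eta0; lra.
  - by rewrite in_itv /=; apply/andP; split => //; have := eta0; lra.
  - by have := eta0; lra.
pose T := (('rV[R]_n * 'rV[R]_n) * (R * R))%type.
have cx : continuous (fun p : T => p.1.1).
  by move=> p; apply: (@cvg_comp _ _ _ fst fst _ (nbhs p.1)); exact: cvg_fst.
have cy : continuous (fun p : T => p.1.2).
  by move=> p; apply: (@cvg_comp _ _ _ fst snd _ (nbhs p.1)); [exact: cvg_fst|exact: cvg_snd].
have cs : continuous (fun p : T => p.2.1).
  by move=> p; apply: (@cvg_comp _ _ _ snd fst _ (nbhs p.2)); [exact: cvg_snd|exact: cvg_fst].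
have cs' : continuous (fun p : T => p.2.2).
  by move=> p; apply: (@cvg_comp _ _ _ snd snd _ (nbhs p.2)); exact: cvg_snd.
have cpow (g : T -> R) k : continuous g -> continuous (fun p => g p ^+ k).
  move=> cg p; apply: (@cvg_comp _ _ _ g (fun s => s ^+ k) _ (nbhs (g p))).
    exact: cg.
  exact: exprn_continuous.
have ccomp (g : T -> 'rV[R]_n) (h : 'rV[R]_n -> R) : continuous g -> continuous h ->
    continuous (fun p => h (g p)).
  move=> cg ch p; apply: (@cvg_comp _ _ _ g h _ (nbhs (g p))); first exact: cg.
  exact: ch.
have cB (g h : T -> R) : continuous g -> continuous h ->
    continuous (fun p => g p - h p).
  by move=> cg ch p; exact: (cvgB (cg p) (ch p)).
have cM (g h : T -> R) : continuous g -> continuous h ->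
    continuous (fun p => g p * h p).
  by move=> cg ch p; exact: (cvgM (cg p) (ch p)).
have cD (g h : T -> R) : continuous g -> continuous h ->
    continuous (fun p => g p + h p).
  by move=> cg ch p; exact: (cvgD (cg p) (ch p)).
have cC (c : R) : continuous (fun p : T => c) by move=> p; exact: cvg_cst.
have cenorm := @continuous_enorm R n.
have cZ : continuous (fun p : T => doubling_gap p.1.1 p.1.2 p.2.1).
  apply: (cB); first by apply: (cB); apply: ccomp.
  by apply: (cM); [exact: cC | apply: cpow; apply: (cM); [exact: cs | exact: cC]].
have clK : closed ([set p : T | p.2.2 + eta - p.2.1 <= 0] `&`
   ([set p | enorm p.1.1 * p.2.1 ^+ N = 1] `&`
    [set p | enorm p.1.2 * p.2.2 ^+ N = 1])).
  have cl1 (g h : T -> R) : continuous g -> continuous h ->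
      closed [set p | g p * h p ^+ N = 1].
    move=> cg ch; apply: (@preimage_closed _ _ (fun p => g p * h p ^+ N) [set 1]).
      by move=> p _; apply: (cM); [exact: cg | exact: cpow].
    exact: closed_eq.
  apply: closedI; last by apply: closedI; apply: cl1 => //; exact: ccomp.
  apply: (@preimage_closed _ _ (fun p : T => p.2.2 + eta - p.2.1)
    [set r | r <= 0] _ (@closed_le _ 0)).
  by move=> p _; apply: (cB) => //; apply: (cD) => //; exact: cC.
have cK : compact K.
  rewrite /K; apply: compact_closedI; last exact: clK.
  by apply: compact_setX; apply: compact_setX;
    (exact: compact_enorm_ball || exact: segment_compact).
have K1 : K ((x1, y1), (s1, s1')).
  apply: pairK => //; rewrite leNgt; apply/negP => /(far _ _ _ _ pair1).
  by rewrite ltNge ltW.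
have cZK : {within K, continuous (fun p : T => doubling_gap p.1.1 p.1.2 p.2.1)}.
  exact: continuous_subspaceT.
have [[[x y] [s s']] /set_mem Kp hmax] := compact_EVT_max (ex_intro _ _ K1) cK cZK.
have Zp : 0 < doubling_gap x y s.
  apply: lt_le_trans Z1 _.
  by apply: (hmax ((x1, y1), (s1, s1'))); exact: mem_set.
exists x, y, s, s'; split => //; first exact: Kpair Kp.
move=> x2 y2 s2 s2' pair2; have [sg|sg] := ltP s2' sig.
  by apply: ltW; apply: lt_trans Zp; exact: far pair2 sg.
by apply: (hmax ((x2, y2), (s2, s2'))); apply: mem_set; exact: pairK.
Qed.

(** At a positive maximum of the gap, [radial_algebra] yields
    s^e f(u(x)) <= s'^e f(u(y)) with e = N (alpha - 2) - 2 > 0.  But s > s',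
    and f(u(x)) >= f(u(y)) > 0 because u(x) > u(y) >= M. *)
Lemma doubling_bound x1 y1 s1 s1' : shifted_pair x1 y1 s1 s1' ->
  u x1 <= u y1 + C0 * (s1 / s0) ^+ m.
Proof.
move=> pair1; rewrite -lerBlDl -subr_le0 leNgt; apply/negP => Z1.
have [x [y [s [s' [a Z0 hmax]]]]] := doubling_max pair1 Z1.
case: (a) => s'0 ss' ss0 xs ys.
have es := eta0.
have s_gt0 : 0 < s by lra.
have s's : s' < s by lra.
have s's0 : s' <= s0 by lra.
have [x1e Mx] := large0 s_gt0 ss0 xs.
have [y1e My] := large0 s'0 s's0 ys.
set h := C0 * (s / s0) ^+ m.
have h0 : 0 <= h by rewrite mulr_ge0 // exprn_ge0 // divr_ge0 // ltW.
have uyx : u y < u x by have := Z0; rewrite /doubling_gap -/h; lra.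
(* on the inner sphere the harmonic term dominates u *)
have s_lt : s < s0.
  rewrite lt_neqAle ss0 andbT; apply/negP => /eqP sE.
  have : u x <= C0 by apply: C0_bound; rewrite -sE xs.
  move: Z0; rewrite /doubling_gap sE divff ?gt_eqF // expr1n mulr1.
  by have := u_gt0 y; lra.
pose nu : R := N%:R; pose k : R := n%:R - 2.
have nu1 : 1 <= nu by rewrite /nu ler1n.
have k1 : 1 <= k by rewrite /k lerBrDr -(natrD _ 1 2) ler_nat.
have mE : m%:R = nu * k :> R.
  by rewrite /m natrM natrB // (leq_trans _ n3).
pose B := half_hess u x; pose G := grad u x.
pose B' := half_hess u y; pose G' := grad u y.
pose P := dot G x; pose Q := quad B x; pose P' := dot G' y; pose Q' := quad B' y.
have S1 : dot x x * \tr B <= Q + (k + 1) / 2 * P.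
  have -> : k + 1 = n%:R - 1 by rewrite /k; ring.
  apply: sphere_max_test => // z zx.
  have : doubling_gap z y s <= doubling_gap x y s.
    by apply: (hmax z y s s'); split => //; rewrite zx.
  by rewrite /doubling_gap; lra.
have S2 : Q' + (k + 1) / 2 * P' <= dot y y * \tr B'.
  have -> : k + 1 = n%:R - 1 by rewrite /k; ring.
  apply: sphere_min_test => // z zy.
  have : doubling_gap x z s <= doubling_gap x y s.
    by apply: (hmax x z s s'); split => //; rewrite zy.
  by rewrite /doubling_gap; lra.
(* th r t rescales a point of parameter r to parameter r + t *)
pose th r (t : R) := ((1 + r^-1 * t)^-1) ^+ N.
have jth r : 0 < r -> jet2 (th r) 1 (- (nu / r)) (nu * (nu + 1) / 2 / r ^+ 2).
  move=> r0; have j1 : jet2 (fun t : R => 1 + r^-1 * t) 1 r^-1 0.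
    by apply: jet2_ext (jet2_poly 1 r^-1 0) => // t; rewrite mul0r addr0.
  apply: jet2_ext (jet2X N (jet2V j1)) => //.
    by rewrite mulrN.
  by rewrite -/nu; field; rewrite gt_eqF.
have jcurve z r : 0 < r -> jet2 (fun t => u (th r t *: z)) (u z)
    (- (nu / r * dot (grad u z) z))
    ((nu / r) ^+ 2 * quad (half_hess u z) z +
      nu * (nu + 1) / 2 / r ^+ 2 * dot (grad u z) z).
  move=> r0; have jc i : jet2 (fun t => (th r t *: z) 0 i) (z 0 i)
      ((- (nu / r) *: z) 0 i) ((nu * (nu + 1) / 2 / r ^+ 2 *: z) 0 i).
    apply: jet2_ext (jet2Z (z 0 i) (jth r r0)) => [t|||]; rewrite ?mxE ?mulr1 //;
      exact: mulrC.
  apply: jet2_ext (jet2_curve u_C2 jc) => //.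
    by rewrite !dotE mulNr.
  by rewrite /quad !bilinE !dotE; ring.
have jh : jet2 (fun t => C0 * ((s + t) / s0) ^+ m) h (h * (nu * k / s))
    (h * (nu * k * (nu * k - 1) / 2 / s ^+ 2)).
  have j1 : jet2 (fun t : R => 1 + s^-1 * t) 1 s^-1 0.
    by apply: jet2_ext (jet2_poly 1 s^-1 0) => // t; rewrite mul0r addr0.
  apply: jet2_ext (jet2Z h (jet2X m j1)) => [t|||].
  - rewrite /h -mulrA -exprMn; congr (_ * _ ^+ _).
    by field; rewrite !gt_eqF.
  - by rewrite mulr1.
  - by rewrite mE.
  - by rewrite mE mulr0 add0r -exprVn; ring.
have near_pos r : 0 < r -> \forall t \near (0 : R), 0 < r + t.
  move=> r0; near=> t.
  have : `|t| <= r / 2 by near: t; apply: near0_le; rewrite divr_gt0.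
  by rewrite ler_norml => /andP[]; lra.
have thpair z r t : 0 < r -> 0 < r + t -> enorm z * r ^+ N = 1 ->
    enorm (th r t *: z) * (r + t) ^+ N = 1.
  move=> r0 rt0 zr.
  have q0 : 0 < 1 + r^-1 * t.
    by rewrite (_ : _ + _ = (r + t) / r) ?divr_gt0 //; field; rewrite gt_eqF.
  rewrite enormZ gtr0_norm ?exprn_gt0 ?invr_gt0 // -zr mulrAC mulrC -exprMn.
  by congr (_ * _ ^+ _); field; rewrite !gt_eqF.
(* t <= 0 moves y outwards *)
have P'0 : 0 <= P'.
  have jy := jcurve y s' s'0.
  have /(jet2_min_left jy) : \forall t \near (0 : R), t <= 0 -> u y <= u (th s' t *: y).
    apply: filterS (near_pos s' s'0) => t st t0.
    have : doubling_gap x (th s' t *: y) s <= doubling_gap x y s.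
      by apply: (hmax _ _ s (s' + t)); split => //; [lra | exact: thpair].
    by rewrite /doubling_gap; lra.
  by rewrite oppr_le0 pmulr_rge0 // divr_gt0 //; lra.
have [E1 E2] : - (nu / s * P) + nu / s' * P' - h * (nu * k / s) = 0 /\
  (nu / s) ^+ 2 * Q + nu * (nu + 1) / 2 / s ^+ 2 * P
    - ((nu / s') ^+ 2 * Q' + nu * (nu + 1) / 2 / s' ^+ 2 * P')
    - h * (nu * k * (nu * k - 1) / 2 / s ^+ 2) <= 0.
  have J := jet2D (jet2D (jcurve x s s_gt0) (jet2Z (- 1) (jcurve y s' s'0)))
    (jet2Z (- 1) jh).
  have [|J1 J2] := jet2_max J.
    have s00 : 0 < s0 - s by lra.
    have H1 := near_pos s' s'0; have H2 := near0_le s00.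
    near=> t.
    have t1 : 0 < s' + t by near: t.
    have t2 : `|t| <= s0 - s by near: t.
    have t3 : s + t <= s0 by have := ler_norm t; lra.
    have t4 : 0 < s + t by lra.
    have : doubling_gap (th s t *: x) (th s' t *: y) (s + t) <= doubling_gap x y s.
      by apply: (hmax _ _ _ (s' + t)); split => //; [lra | exact: thpair | exact: thpair].
    by rewrite /doubling_gap -/h; lra.
  split; first by rewrite -J1 /P /P' /G /G'; ring.
  by apply: le_trans J2; rewrite le_eqVlt; apply/orP; left; apply/eqP;
    rewrite /P /P' /Q /Q' /B /B' /G /G'; ring.
have := radial_algebra s'0 s's nu1 k1 P'0 E1 E2 S1 S2.
rewrite !u_eq -!enorm_sqr.
have W1 := weight_powR s_gt0 xs x1e; have W2 := weight_powR s'0 ys y1e.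
have -> : enorm x ^+ 2 * (rho x * f (u x) / 2) / s ^+ 2 =
  s `^ (N%:R * (alpha - 2) - 2) * f (u x) / 2 by rewrite -W1; ring.
have -> : enorm y ^+ 2 * (rho y * f (u y) / 2) / s' ^+ 2 =
  s' `^ (N%:R * (alpha - 2) - 2) * f (u y) / 2 by rewrite -W2; ring.
apply/negP; rewrite -ltNge.
have e0 : 0 < N%:R * (alpha - 2) - 2 by rewrite subr_gt0.
have : s' `^ (N%:R * (alpha - 2) - 2) < s `^ (N%:R * (alpha - 2) - 2).
  by apply: gt0_ltr_powR => //; rewrite nnegrE ltW.
have := powR_gt0 (N%:R * (alpha - 2) - 2) s'0.
have := f_mono My (ltW uyx); have := f_gt0 (u_gt0 y).
move: (s `^ _) (s' `^ _) => w w'; nra.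
Unshelve. all: by end_near. Qed.

End doubling.

(** For given x and y, eta is the difference of their parameters; the harmonic
    term is at most C0 (s / s0)^N, a constant over |x|. *)
Lemma almost_monotone eps : 0 < eps -> exists r, forall x y,
  r < enorm x -> enorm x < enorm y -> u x <= u y + eps.
Proof.
move=> eps0.
have a20 : 0 < alpha - 2 by rewrite subr_gt0.
pose N := (Num.bound (2 / (alpha - 2))).+1.
have N0 : (0 < N)%N by [].
have Na : 2 < N%:R * (alpha - 2).
  rewrite -ltr_pdivrMr // (lt_trans (archi_boundP _)) ?divr_ge0 ?(ltW a20) //.
  by rewrite ltr_nat.
have [r0 hr0] := u_large M.
pose s0 := (1 + `|r0|)^-1.
have s00 : 0 < s0 by rewrite invr_gt0 ltr_pwDl.
have s01 : s0 <= 1 by rewrite invf_le1 ?ltr_pwDl // lerDl.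
have inv_ge (x : 'rV[R]_n) s : 0 < s -> s <= s0 -> enorm x * s ^+ N = 1 ->
    1 + `|r0| <= enorm x.
  move=> sp ss xs; have sN : 0 < s ^+ N by rewrite exprn_gt0.
  have -> : enorm x = s ^- N.
    by rewrite -[LHS](mulfK (_ : s ^+ N != 0)) ?gt_eqF // xs mul1r.
  have s1 : s <= 1 := le_trans ss s01.
  rewrite -[leLHS]invrK lef_pV2 ?posrE //; apply: le_trans ss.
  by rewrite -[leRHS]expr1 ler_wiXn2l // ltW.
have large0 (x : 'rV[R]_n) s : 0 < s -> s <= s0 -> enorm x * s ^+ N = 1 ->
    1 <= enorm x /\ M <= u x.
  move=> sp ss xs; have xr := inv_ge x s sp ss xs; split.
    by apply: le_trans xr; rewrite lerDl.
  by apply/ltW/hr0; have := ler_norm r0; lra.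
have [C0 C00 hC0] := continuous_bounded_on_ball (s0 ^- N) cu.
have s0N : 0 < s0 ^+ N by rewrite exprn_gt0.
have C0b (x : 'rV[R]_n) : enorm x * s0 ^+ N <= 1 -> u x <= C0.
  by move=> h; apply: hC0; rewrite -[leRHS]mul1r ler_pdivlMr.
exists (Num.max (s0 ^- N) (C0 / s0 ^+ N / eps)) => x y.
rewrite gt_max => /andP[xr1 xr2] xy.
have x0 : 0 < enorm x by apply: lt_trans xr1; rewrite invr_gt0.
have [s sp xs] := exists_root_inv N0 x0.
have [s' s'p ys] := exists_root_inv N0 (lt_trans x0 xy).
have sNE : s ^+ N = (enorm x)^-1.
  by rewrite -[RHS]mulr1 -xs mulKf // gt_eqF.
have s'NE : s' ^+ N = (enorm y)^-1.
  by rewrite -[RHS]mulr1 -ys mulKf // gt_eqF // (lt_trans x0).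
have ss0 : s <= s0.
  rewrite -(ler_pXn2r N0) ?nnegrE ?(ltW sp) ?(ltW s00) // sNE -[leRHS]invrK.
  by rewrite lef_pV2 ?posrE ?invr_gt0 // ltW.
have s's : s' < s.
  rewrite -(ltr_pXn2r N0) ?nnegrE ?(ltW sp) ?(ltW s'p) // sNE s'NE.
  by rewrite ltf_pV2 ?posrE // (lt_trans x0).
have eta0 : 0 < s - s' by rewrite subr_gt0.
have a : shifted_pair N s0 (s - s') x y s s' by split => //; rewrite addrC subrK.
apply: (le_trans (doubling_bound N0 Na s00 s01 C00 eta0 C0b large0 a)).
rewrite lerD2l.
have r1 : 0 <= s / s0 <= 1.
  by apply/andP; split; [rewrite divr_ge0 // ltW | rewrite ler_pdivrMr // mul1r].
have -> : C0 * (s / s0) ^+ (N * (n - 2)) = C0 * ((s / s0) ^+ N) ^+ (n - 2).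
  by rewrite exprM.
apply: (@le_trans _ _ (C0 * (s / s0) ^+ N)).
  rewrite ler_wpM2l // -[leRHS]expr1 ler_wiXn2l //.
  - by rewrite exprn_ge0 //; case/andP: r1.
  - by rewrite exprn_ile1 //; case/andP: r1.
  - by rewrite subn_gt0.
rewrite expr_div_n sNE mulrCA -ler_pdivlMl ?invr_gt0 // invrK.
by move: xr2; rewrite ltr_pdivrMr // => /ltW.
Qed.

End large_solutions.

(** * Bounds from the hypotheses, and radial symmetry *)

Lemma C1_half_line_lipschitz (R : realType) (f : R -> R) (K : R) :
  C1_half_line f -> exists2 L, 0 <= L &
  forall p q, 0 < p <= K -> 0 < q <= K -> `|f p - f q| <= L * `|p - q|.
Proof.
move=> [f' [df cf']].
have [K0|K0] := leP K 0.
  by exists 0 => // p q /andP[p0 pK]; have := lt_le_trans p0 pK; rewrite ltNge K0.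
have cK : {within `[0, K], continuous f'}.
  apply: continuous_subspaceW cf' => t /=; rewrite !in_itv /= => /andP[-> _] //.
have [c1 _ h1] := EVT_max (ltW K0) cK.
have [c2 _ h2] := EVT_min (ltW K0) cK.
have L0 : 0 <= `|f' c1| + `|f' c2| by rewrite addr_ge0.
exists (`|f' c1| + `|f' c2|) => //.
have fd (t : R) : 0 < t -> is_derive t 1 f (f' t).
  move=> t0; apply: is_derive_eps => e e0.
  have /cvgrPdist_le /(_ e e0) := df t (ltW t0).
  move=> /nbhs_ballP[d /= d0 H].
  apply/nbhs_ballP; exists (Num.min d t) => /=; first by rewrite lt_min d0.
  move=> s; rewrite /ball /= sub0r normrN lt_min => /andP[sd st].
  have [->|s0] := eqVneq s 0.
    by rewrite add0r subrr mul0r subrr normr0 mulr0.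
  have := H (s + t); rewrite /ball /= opprD addrCA subrr addr0 normrN => /(_ sd).
  have -> : s + t == t = false by rewrite -subr_eq0 addrK (negbTE s0).
  move=> /(_ isT); rewrite in_itv /= andbT addrK => h.
  have st0 : 0 <= s + t by move: st; rewrite ltr_norml => /andP[]; lra.
  have -> : f (s + t) - f t - s * f' t = - (s * (f' t - (f (s + t) - f t) / s)).
    by field.
  by rewrite normrN normrM mulrC ler_wpM2r // h.
have main p q : 0 < p -> p <= q -> q <= K ->
    `|f p - f q| <= (`|f' c1| + `|f' c2|) * `|p - q|.
  move=> p0 pq qK.
  have fpq (t : R) : t \in `]p, q[ -> is_derive t 1 f (f' t).
    by rewrite in_itv /= => /andP[pt _]; apply: fd; exact: lt_trans pt.
  have cpq : {within `[p, q], continuous f}.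
    apply: derivable_within_continuous => t; rewrite in_itv /= => /andP[pt _].
    by case: (fd t (lt_le_trans p0 pt)).
  have [c] := MVT_segment pq fpq cpq.
  rewrite in_itv /= => /andP[pc cq] E.
  rewrite distrC E normrM (distrC p) ler_wpM2r //.
  have cin : c \in `[0, K] by rewrite in_itv /=; apply/andP; split; lra.
  have := h1 c cin; have := h2 c cin.
  have := ler_norm (f' c1); have := ler_norm (- f' c2); rewrite normrN.
  have := normr_ge0 (f' c1); have := normr_ge0 (f' c2).
  by move=> *; rewrite ler_norml; apply/andP; split; lra.
move=> p q /andP[p0 pK] /andP[q0 qK]; have [pq|qp] := leP p q.
  exact: main.
by rewrite distrC (distrC p); apply: main => //; exact: ltW.
Qed.

Section global.
Context {R : realType} {n : nat}.
Implicit Types (u : 'rV[R]_n -> R) (x y : 'rV[R]_n).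

Lemma max_trace_le0 u x : class_C 2 u -> (forall y, u y <= u x) ->
  \tr (half_hess u x) <= 0.
Proof.
move=> uC ux; apply: sumr_le0 => i _.
have [|_] := jet2_max (jet2_line x (basis_vec i) uC).
  by near=> t; exact: ux.
by rewrite /quad bilin_basis.
Unshelve. all: by end_near. Qed.

Lemma at_infinity_gt u (beta : \bar R) c :
  (u x)%:E @[x --> at_infinity] --> beta -> (c%:E < beta)%E ->
  exists r, forall x, r < enorm x -> c < u x.
Proof.
move=> ul cb; have [|r _ hr] := ul [set y | (c%:E < y)%E].
  by apply: open_nbhs_nbhs; split => //; exact: open_ereal_gt_ereal.
by exists r => x /hr /=; rewrite lte_fin.
Qed.

Lemma at_infinity_lt u (beta : \bar R) c :
  (u x)%:E @[x --> at_infinity] --> beta -> (beta < c%:E)%E ->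
  exists r, forall x, r < enorm x -> u x < c.
Proof.
move=> ul cb; have [|r _ hr] := ul [set y | (y < c%:E)%E].
  by apply: open_nbhs_nbhs; split => //; exact: open_ereal_lt_ereal.
by exists r => x /hr /=; rewrite lte_fin.
Qed.

(** If u reached its limit at infinity it would have a global maximum, where the
    Laplacian is at most 0. *)
Lemma subharmonic_lt_limit u (beta : \bar R) x : class_C 2 u ->
  (forall y, 0 < \tr (half_hess u y)) ->
  (u x)%:E @[x --> at_infinity] --> beta -> ((u x)%:E < beta)%E.
Proof.
move=> uC utr ul; rewrite ltNge; apply/negP => bu.
suff [x0 /(max_trace_le0 uC)] : exists x0, forall y, u y <= u x0.
  by rewrite leNgt utr.
have [h|] := pselect (forall y, ((u y)%:E <= beta)%E).
  by exists x => y; have := le_trans (h y) bu; rewrite lee_fin.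
move=> /existsNP[x2 /negP]; rewrite -ltNge => bu2.
have [r hr] := at_infinity_lt ul bu2.
pose r' := Num.max r (enorm x2).
have cu : {within [set y : 'rV[R]_n | enorm y <= r'], continuous u}.
  by apply: continuous_subspaceT; case: uC.
have B2 : [set y : 'rV[R]_n | enorm y <= r'] x2 by rewrite /= /r' le_max lexx orbT.
have [x0 _ hx] := compact_EVT_max (ex_intro _ _ B2) (@compact_enorm_ball _ _ r') cu.
exists x0 => y; have [yr|yr] := leP (enorm y) r'; first by apply: hx; exact: mem_set.
apply: (@le_trans _ _ (u x2)); last by apply: hx; exact: mem_set.
by apply/ltW/hr; apply: le_lt_trans yr; rewrite le_max lexx.
Qed.

(** Two points of equal norm are mirror images in the hyperplane through 0
    orthogonal to their difference, and each can play the role of x. *)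
Lemma radial_of_reflections u :
  (forall e x, dot e e = 1 -> 0 < dot x e -> u (mirror e 0 x) <= u x) -> radial u.
Proof.
move=> h.
suff H x y : enorm x = enorm y -> u y <= u x.
  by move=> x y xy; apply/eqP; rewrite eq_le !H.
move=> xy; have [->//|ne] := eqVneq x y.
pose d := enorm (x - y).
have d0 : 0 < d.
  rewrite lt_neqAle enorm_ge0 andbT eq_sym; apply/eqP => /enorm0_eq0 /eqP.
  by rewrite subr_eq0 (negbTE ne).
have dd : dot (x - y) (x - y) = d ^+ 2 by rewrite -enorm_sqr.
pose e := d^-1 *: (x - y).
have e1 : dot e e = 1 by rewrite /e dotZl dotZr dd; field; rewrite gt_eqF.
have xe : dot x e = d / 2.
  have xyd : dot x x = dot y y by rewrite -!enorm_sqr xy.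
  have : 2 * dot x (x - y) = d ^+ 2.
    by rewrite -dd !dotE (dotC y x) -xyd; ring.
  move=> E; rewrite /e dotZr (_ : dot x (x - y) = d ^+ 2 / 2); last by lra.
  by field; rewrite gt_eqF.
have <- : mirror e 0 x = y.
  rewrite /mirror xe subr0 /e scalerA (_ : 2 * (d / 2) * d^-1 = 1) ?scale1r.
    by rewrite subKr.
  by field; rewrite gt_eqF.
by apply: h => //; rewrite xe divr_gt0.
Qed.

End global.

Theorem corollary2p13 (R : realType) (D : nat) (hD : (3 <= D)%N)
  (beta : \bar R) (beta_gt0 : (0 < beta)%E)
  (a : R) (a_gt0 : 0 < a)
  (f : R -> R) (f_C1 : C1_half_line f)
  (f_neq0 : exists t, 0 <= t /\ f t <> 0)
  (f0 : f 0 = 0) (f_gt0 : forall t, 0 < t -> 0 < f t)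
  (f_KO : keller_osserman a f)
  (rho : 'rV[R]_D -> R) (rho_gt0 : forall x, 0 < rho x) (rho_C1 : class_C 1 rho)
  (rho_potential : newton_potential rho x @[x --> at_infinity] --> 0%E)
  (M : R) (M_ge0 : 0 <= M) (M_lt_beta : (M%:E < beta)%E)
  (f_mono : forall s t, M <= s -> s <= t -> (t%:E < beta)%E -> f s <= f t)
  (rho_decr : radially_decreasing rho)
  (alpha : R) (alpha_gt2 : 2 < alpha)
  (rho_powR : forall x, 1 <= enorm x -> rho x = enorm x `^ (- alpha))
  (u : 'rV[R]_D -> R) (u_C2 : class_C 2 u)
  (u_eq : forall x, laplacian u x = rho x * f (u x))
  (u_gt0 : forall x, 0 < u x)
  (u_lim : (u x)%:E @[x --> at_infinity] --> beta) :
  radial u.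
Proof.
have u_eq2 x : \tr (half_hess u x) = rho x * f (u x) / 2.
  by rewrite tr_half_hess u_eq.
have u_tr x : 0 < \tr (half_hess u x).
  by rewrite u_eq2 divr_gt0 // mulr_gt0 // f_gt0.
have u_lt x : ((u x)%:E < beta)%E by exact: subharmonic_lt_limit.
have [R0 hR0] := at_infinity_gt u_lim M_lt_beta.
have [_ rho_lt] := rho_decr.
have f_mono_u x y : R0 + 1 <= enorm x -> u x < u y -> f (u x) <= f (u y).
  move=> xR xy; apply: f_mono (ltW xy) (u_lt y).
  by apply/ltW/hR0; apply: lt_le_trans xR; rewrite ltrDl.
have u_far eps : 0 < eps -> exists r, forall x y,
    r < enorm x -> enorm x < enorm y -> u x <= u y + eps.
  move=> eps0; case: beta => [b| |] in u_lim u_lt f_mono M_lt_beta beta_gt0 *.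
  - have be : ((b - eps)%:E < b%:E)%E by rewrite lte_fin ltrBlDr ltrDl.
    have [r hr] := at_infinity_gt u_lim be.
    exists r => x y xr xy; have := u_lt x; rewrite lte_fin.
    by have := hr y (lt_trans xr xy); lra.
  - apply: (almost_monotone (M := M) hD u_C2 u_eq2 u_gt0 f_gt0 _ alpha_gt2
      rho_powR) => //.
      by move=> s t Ms st; apply: f_mono => //; exact: ltry.
    by move=> A; exact: (at_infinity_gt u_lim (ltry A)).
  - by move: beta_gt0; rewrite ltNge leNye.
apply: radial_of_reflections => e x e1 xe.
apply: (plane_le0 u_C2 u_eq2 u_gt0 f_gt0 rho_gt0 rho_lt f_mono_u _ u_far e1) => //.
by move=> K; exact: C1_half_line_lipschitz.
Qed.
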